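(* Let $G$ be a chordal graph on $[n]$ with the property that any two distinct maximal cliques of $G$ intersect in at most one vertex. Then $\operatorname{reg}(S/J_G)\le r$, where $r$ is the number of maximal cliques of $G$.
   Context: Let $K$ be a field and $S=K[x_1,\ldots,x_n,y_1,\ldots,y_n]$ the standard graded polynomial ring in $2n$ variables. Graphs are finite and simple. For a graph $G$ on $[n]=\{1,\ldots,n\}$ with edge set $E(G)$, the binomial edge ideal of $G$ is $J_G=(x_iy_j-x_jy_i : \{i,j\}\in E(G),\ i<j)\subset S$, and $\operatorname{reg}$ denotes Castelnuovo--Mumford regularity over $S$. A graph is chordal if it has no induced cycle of length at least $4$. Maximal cliques are the inclusion-maximal sets of pairwise adjacent vertices (the facets of the clique complex of $G$). *)

(* Defs.v *)
From HB Require Import structures.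
From mathcomp Require Import all_boot all_order all_algebra.
From mathcomp Require Import mpoly.

Set Implicit Arguments.
Unset Strict Implicit.
Unset Printing Implicit Defensive.

Import GRing.Theory.
Local Open Scope ring_scope.

Section Graphs.
Variables (n : nat) (G : rel 'I_n).

Definition is_clique (A : {set 'I_n}) : bool :=
  [forall i in A, forall j in A, (i != j) ==> G i j].

Definition maximal_cliques : {set {set 'I_n}} :=
  [set A | maxset is_clique A].

(* [next c i] is the cyclic successor of [i] in [c]: the edges of G between
   vertices of [c] are exactly those of the cycle [c]. *)
Definition is_induced_cycle (c : seq 'I_n) : Prop :=
  [/\ (3 <= size c)%N, uniq c &
      {in c &, forall i j, G i j = (j == next c i) || (i == next c j)}].

Definition chordal : Prop :=
  forall c : seq 'I_n, is_induced_cycle c -> (size c < 4)%N.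

End Graphs.

(* The ideal generated by the [f i] such that [P i]. *)
Definition ideal_gen (R : comNzRingType) (I : finType) (P : pred I)
    (f : I -> R) : R -> Prop :=
  fun p => exists c : I -> R, p = \sum_(i | P i) c i * f i.

Section BinomialEdgeIdeal.
Variables (K : fieldType) (n : nat).

(* The first n of the n + n variables are the x_i, the last n are the y_i. *)
Definition xvar (i : 'I_n) : {mpoly K[n + n]} := 'X_(lshift n i).
Definition yvar (i : 'I_n) : {mpoly K[n + n]} := 'X_(rshift n i).

Definition binomial_edge_ideal (G : rel 'I_n) : {mpoly K[n + n]} -> Prop :=
  ideal_gen (fun e : 'I_n * 'I_n => (e.1 < e.2)%N && G e.1 e.2)
            (fun e => xvar e.1 * yvar e.2 - xvar e.2 * yvar e.1).

End BinomialEdgeIdeal.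

Section Regularity.
Variables (K : fieldType) (m : nat).
Local Notation S := {mpoly K[m]}.

(* [p] belongs to the component of degree [a] of S(-b), i.e. it is zero or
   homogeneous of degree a - b. *)
Definition shift_homog (a b : nat) (p : S) : bool :=
  if (b <= a)%N then p \is (a - b).-homog else p == 0.

(* Free modules ... -> F_2 -> F_1 -> F_0 with F_i the direct sum of the
   S(-(gdeg i k)), k < grank i, together with F_0 -> S.  Elements are row
   vectors and maps act by right multiplication; [gaug] lifts to S the
   augmentation F_0 -> S/J. *)
Record free_complex := FreeComplex {
  grank : nat -> nat;
  gdeg : forall i, 'I_(grank i) -> nat;
  gdiff : forall i, 'M[S]_(grank i.+1, grank i);
  gaug : 'cV[S]_(grank 0)
}.

Definition is_graded (F : free_complex) : Prop :=
  (forall k, shift_homog (gdeg k) 0 (gaug F k 0)) /\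
  (forall i k l, shift_homog (gdeg k) (gdeg l) (gdiff F i k l)).

(* Exactness of ... -> F_1 -> F_0 -> S/J -> 0. *)
Definition resolves (F : free_complex) (J : S -> Prop) : Prop :=
  [/\ forall p : S, exists u : 'rV[S]_(grank F 0),
        J (p - (u *m gaug F) 0 0),
      forall u : 'rV[S]_(grank F 0),
        J ((u *m gaug F) 0 0) <-> exists v, u = v *m gdiff F 0
    & forall i (u : 'rV[S]_(grank F i.+1)),
        u *m gdiff F i = 0 <-> exists v, u = v *m gdiff F i.+1].

(* The image of F_(i+1) lies in mF_i, for m the ideal of the variables. *)
Definition is_minimal (F : free_complex) : Prop :=
  forall i k l, (gdiff F i k l)@_0%MM = 0.

Definition minimal_graded_free_resolution (F : free_complex) (J : S -> Prop) :
    Prop :=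
  [/\ is_graded F, resolves F J & is_minimal F].

(* The rank of S(-j) in F_i: the graded Betti number beta_(i,j) of S/J when F
   is a minimal graded free resolution of S/J. *)
Definition betti (F : free_complex) (i j : nat) : nat :=
  #|[set k : 'I_(grank F i) | gdeg k == j]|.

(* reg(S/J) <= r, where
   reg(S/J) = sup {j - i | beta_(i,j)(S/J) <> 0}.  The Betti numbers are read
   off any minimal graded free resolution, which is unique up to
   isomorphism. *)
Definition reg_quotient_le (J : S -> Prop) (r : nat) : Prop :=
  forall F : free_complex, minimal_graded_free_resolution F J ->
  forall i j : nat, betti F i j <> 0%N -> (j%:Z - i%:Z <= r%:Z :> int).

End Regularity.

(* Main.v *)
Require Import Defs.
From HB Require Import structures.
From mathcomp Require Import all_boot all_order all_algebra.
From mathcomp Require Import mpoly ring zify.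

(** The argument is an induction on a family [Bs] of vertex sets, called
    blocks: two distinct vertices are adjacent when some block contains both.
    For a set [D] of dead vertices, let [I(Bs, D)] be generated by the edge
    binomials and by the two variables of each vertex of [D].  The claim is
    that [reg (S / I(Bs, D))] is at most the number of blocks
    ([reg_clique_cover]); the theorem is the case where the blocks are the
    maximal cliques and [D] is empty.

    - If a live vertex [i] lies in two blocks, let [Bs'] be obtained by merging
      all the blocks through [i].  Then
      [I(Bs, D) = I(Bs', D) :&: I(Bs, i |: D)], with sum [I(Bs', i |: D)]
      (Ohtani's decomposition), and [Bs'] has fewer blocks ([reg_merge_blocks]).
    - Otherwise the live parts of the blocks are disjoint cliques.  A variable
      [x_i] of a live vertex is then a nonzerodivisor ([toric_nzd]: the ideal
      is the kernel of a monomial map), so that it can be added to the ideal.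
      If [i] lies in the block [C], the ideal so obtained is the intersection of
      the one where all the [x_j], [j] in [C], are killed, whose regularity is
      that of the graph without [C], and of the one where [i] is dead
      ([reg_remove_clique_vertex]).
    - When every vertex is dead the quotient is the field [K].

    The exact sequence [0 -> S/(I1 :&: I2) -> S/I1 (+) S/I2 -> S/(I1 + I2) -> 0]
    thus gives every bound, once regularity is known to behave well along it.
    This is clear on Koszul homology, which computes [Tor(K, S/I)]: the
    predicate [koszul_reg_le I r] says that the Koszul homology of [S/I]
    vanishes above the line of slope one through [r], and its behaviour along
    the exact sequence and modulo a nonzerodivisor are short diagram chases
    ([koszul_reg_cap], [koszul_reg_nzd]).  Finally [koszul_reg_quotient]
    transfers the vanishing to the Betti numbers of a given minimal free
    resolution: by exactness of the Koszul complex on free modules, Koszul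
    homology shifts by one from each syzygy module to the next, and a generator
    of the [i]-th free module of too large a degree would be a boundary, hence
    would lie in the maximal ideal times that module. *)

Set Implicit Arguments.
Unset Strict Implicit.
Unset Printing Implicit Defensive.

Import GRing.Theory.
Local Open Scope ring_scope.

(** * Koszul chains and the exactness of the Koszul complex *)

Section KoszulChains.
Variable R : comNzRingType.

(** The Koszul complex on [k] elements of the ring, with coefficients in [V], is
    built by iterated mapping cones: a chain on [k.+1] elements is a pair
    [(u, v)] standing for [u + e_k /\ v], up to sign.  All exterior degrees are
    kept together, and the recursion takes care of the signs. *)
Fixpoint kchain (V : lmodType R) k : lmodType R :=
  if k is k'.+1 then ((kchain V k' * kchain V k')%type : lmodType R) else V.

Fixpoint kall (V : lmodType R) (P : V -> Prop) k : kchain V k -> Prop :=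
  if k is k'.+1 then
    fun c : kchain V k' * kchain V k' => kall P c.1 /\ kall P c.2
  else P.

Fixpoint kmap (V W : lmodType R) (f : V -> W) k : kchain V k -> kchain W k :=
  if k is k'.+1 then
    fun c : kchain V k' * kchain V k' => (kmap f c.1, kmap f c.2)
  else f.

(** The component of exterior degree [0]. *)
Fixpoint kscalar (V : lmodType R) k : kchain V k -> V :=
  if k is k'.+1 then fun c : kchain V k' * kchain V k' => kscalar c.1 else id.

Fixpoint kinj (V : lmodType R) k : V -> kchain V k :=
  if k is k'.+1 then fun v => (kinj k' v, 0) else id.

Record submod_pred (V : lmodType R) (P : V -> Prop) : Prop := SubmodPred {
  submod0 : P 0;
  submodD : forall u v, P u -> P v -> P (u + v);
  submodZ : forall a u, P u -> P (a *: u)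
}.

Section Submod.
Variables (V : lmodType R) (P : V -> Prop).
Hypothesis subP : submod_pred P.
Lemma submodN u : P u -> P (- u).
Proof. by rewrite -scaleN1r; apply: submodZ. Qed.
Lemma submodB u v : P u -> P v -> P (u - v).
Proof. by move=> Pu /submodN; apply: submodD. Qed.
End Submod.

Lemma kall_submod (V : lmodType R) (P : V -> Prop) k :
  submod_pred P -> submod_pred (@kall V P k).
Proof.
move=> subP; elim: k => //= k [IH0 IHD IHZ]; split=> /=; first by split.
  by move=> u v [Pu1 Pu2] [Pv1 Pv2]; split; apply: IHD.
by move=> a u [Pu1 Pu2]; split; apply: IHZ.
Qed.

Section ChainMaps.
Variables V W : lmodType R.

Lemma kall_kmap (P : V -> Prop) (Q : W -> Prop) (f : V -> W) k
    (c : kchain V k) :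
  (forall v, P v -> Q (f v)) -> kall P c -> kall Q (kmap f c).
Proof.
by move=> PQ; elim: k c => [|k IH] c /=; [apply: PQ | case=> /IH ? /IH].
Qed.

Lemma kall_kmapK (Q : W -> Prop) (f : V -> W) k (c : kchain V k) :
  kall Q (kmap f c) -> kall (fun v => Q (f v)) c.
Proof. by elim: k c => [|k IH] c //= [/IH ? /IH]. Qed.

Lemma kall_imp (P Q : V -> Prop) k (c : kchain V k) :
  (forall v, P v -> Q v) -> kall P c -> kall Q c.
Proof.
by move=> PQ; elim: k c => [|k IH] c /=; [apply: PQ | case=> /IH ? /IH].
Qed.

Lemma kall_forall (P : V -> Prop) k (c : kchain V k) :
  (forall v, P v) -> kall P c.
Proof. by move=> PT; elim: k c => [|k IH] c //=; split; apply: IH. Qed.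

Lemma kall_imp2 (P Q T : V -> Prop) k (c : kchain V k) :
  (forall v, P v -> Q v -> T v) -> kall P c -> kall Q c -> kall T c.
Proof.
move=> PQT; elim: k c => [|k IH] c /=; first exact: PQT.
by case=> ? ? [? ?]; split; apply: IH.
Qed.

Lemma kall_lift (P : V -> Prop) (f : W -> V) k (c : kchain V k) :
  (forall v, P v -> exists w, v = f w) ->
  kall P c -> exists c', c = kmap f c'.
Proof.
move=> Pf; elim: k c => [|k IH] /=; first exact: Pf.
by case=> c1 c2 /= [/IH[c1' ->] /IH[c2' ->]]; exists (c1', c2').
Qed.

(** Decompositions of coefficients are chosen entry by entry; this replaces
    short exact sequences of coefficient modules. *)
Lemma kall_split (P P1 P2 : V -> Prop) k (c : kchain V k) :
    (forall v, P v -> exists v1 v2, [/\ P1 v1, P2 v2 & v = v1 + v2]) ->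
  kall P c -> exists c1 c2, [/\ kall P1 c1, kall P2 c2 & c = c1 + c2].
Proof.
move=> PS; elim: k c => [|k IH] /=; first exact: PS.
case=> c d /= [/IH[c1 [c2 [? ? ->]]] /IH[d1 [d2 [? ? ->]]]].
by exists (c1, d1), (c2, d2).
Qed.

Lemma kmap_scale (f g : V -> W) a k (c : kchain V k) :
  (forall v, f (a *: v) = a *: g v) -> kmap f (a *: c) = a *: kmap g c.
Proof. by move=> fg; elim: k c => [|k IH] c /=; rewrite ?fg // !IH. Qed.

Lemma kmapB (f : {additive V -> W}) k (c d : kchain V k) :
  kmap f (c - d) = kmap f c - kmap f d.
Proof. by elim: k c d => [|k IH] c d /=; rewrite ?raddfB // !IH. Qed.

Lemma kscalar_kmap (f : V -> W) k (c : kchain V k) :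
  kscalar (kmap f c) = f (kscalar c).
Proof. by elim: k c => [|k IH] c //=. Qed.

End ChainMaps.

HB.instance Definition _ (V W : lmodType R) (f : {additive V -> W}) k :=
  GRing.isZmodMorphism.Build _ _ (@kmap V W f k) (@kmapB V W f k).

Lemma kmap_scaler (V : lmodType R) a k (c : kchain V k) :
  kmap (fun v => a *: v) c = a *: c.
Proof. by elim: k c => [|k IH] //= c; rewrite !IH. Qed.

Lemma kmap_eq_id (V : lmodType R) (f : V -> V) k (c : kchain V k) :
  kall (fun v => f v = v) c -> kmap f c = c.
Proof. by elim: k c => [|k IH] //= [c1 c2] /= [/IH-> /IH->]. Qed.

Lemma kall_eq0 (V : lmodType R) k (c : kchain V k) :
  kall (fun v => v = 0) c <-> c = 0.
Proof.
elim: k c => [|k IH] //= [c1 c2] /=.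
by rewrite (IH c1) (IH c2); split=> [[-> ->]|[-> ->]].
Qed.

Section KoszulDifferential.
Variable x : nat -> R.

(** The differential of the mapping cone of multiplication by [x k]. *)
Fixpoint kdiff (V : lmodType R) k : kchain V k -> kchain V k :=
  if k is k'.+1 then
    fun c : kchain V k' * kchain V k' =>
      (kdiff c.1 + x k' *: c.2, - kdiff c.2)
  else fun=> 0.

(** Exterior product with the [a]-th basis vector, the homotopy of
    [kdiff_kwedge]. *)
Fixpoint kwedge (V : lmodType R) a k : kchain V k -> kchain V k :=
  if k is k'.+1 then
    fun c : kchain V k' * kchain V k' =>
      if a == k' then (0, c.1) else (kwedge a c.1, - kwedge a c.2)
  else fun=> 0.

Section Differential.
Variable V : lmodType R.

Lemma kdiff_linear k : linear (@kdiff V k).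
Proof.
elim: k => [|k IH] a u v /=; first by rewrite scaler0 addr0.
congr (_, _); last by rewrite IH opprD -scalerN.
change (kdiff (a *: u.1 + v.1) + x k *: (a *: u.2 + v.2) =
  a *: (kdiff u.1 + x k *: u.2) + (kdiff v.1 + x k *: v.2)).
by rewrite IH !scalerDr !scalerA [x k * a]mulrC addrACA.
Qed.

HB.instance Definition _ k :=
  GRing.isLinear.Build R _ _ _ (@kdiff V k) (@kdiff_linear k).

Lemma kdiff_kdiff k (c : kchain V k) : kdiff (kdiff c) = 0.
Proof.
elim: k c => [|k IH] //= c.
by rewrite linearD linearZ !linearN /= !IH add0r subrr !oppr0.
Qed.

(** Each [x a] acts as zero on Koszul homology, for it is homotopic to zero. *)
Lemma kdiff_kwedge a k (c : kchain V k) : (a < k)%N ->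
  kdiff (kwedge a c) + kwedge a (kdiff c) = x a *: c.
Proof.
elim: k c => [|k IH] // [c1 c2]; rewrite ltnS leq_eqVlt /=.
case: eqP => [-> _ /=|_ /= lak].
  by rewrite linear0 add0r; congr (_, _); rewrite /= ?addr0 // addKr.
have kwedgeD : forall k (u v : kchain V k), kwedge a (u + v) = kwedge a u + kwedge a v.
  elim=> [|k' IH'] u v /=; first by rewrite addr0.
  case: eqP => _; first by congr (_, _); rewrite /= addr0.
  by rewrite !IH' opprD.
have kwedgeZ : forall b k (u : kchain V k), kwedge a (b *: u) = b *: kwedge a u.
  move=> b; elim=> [|k' IH'] u /=; first by rewrite scaler0.
  case: eqP => _; first by congr (_, _); rewrite /= scaler0.
  by rewrite !IH' -scalerN.
rewrite kwedgeD kwedgeZ; congr (_, _) => /=.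
  by rewrite scalerN addrACA addNr addr0 IH.
by rewrite linearN opprK -[- kdiff c2]scaleN1r kwedgeZ scaleN1r opprK IH.
Qed.

Lemma kall_kdiff (P : V -> Prop) k (c : kchain V k) :
  submod_pred P -> kall P c -> kall P (kdiff c).
Proof.
move=> subP; elim: k c => [|k IH] /=; first by move=> _ _; apply: submod0.
have [P0 PD PZ] := kall_submod k subP.
case=> c1 c2 /= [/IH Pc1 Pc2]; split; first by apply: PD (PZ _ _ _).
by apply: submodN (IH _ Pc2); apply: kall_submod.
Qed.

Lemma kall_kwedge (P : V -> Prop) a k (c : kchain V k) :
  submod_pred P -> kall P c -> kall P (kwedge a c).
Proof.
move=> subP; elim: k c => [|k IH] /=; first by move=> _ _; apply: submod0.
have subk := kall_submod k subP.
case=> c1 c2 /= [Pc1 Pc2]; case: eqP => _ /=; split=> //.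
- exact: submod0.
- exact: IH.
- by apply: submodN (IH _ Pc2).
Qed.

Definition span_below j (v : V) : Prop :=
  exists w : nat -> V, v = \sum_(i < j) x i *: w i.

Lemma span_below0 j : span_below j 0.
Proof. by exists (fun=> 0); rewrite big1 // => i _; rewrite scaler0. Qed.

Lemma span_belowD j u v : span_below j u -> span_below j v -> span_below j (u + v).
Proof.
case=> w -> [w' ->]; exists (fun i => w i + w' i).
by rewrite -big_split; apply: eq_bigr => i _; rewrite scalerDr.
Qed.

Lemma span_belowZ j a u : span_below j u -> span_below j (a *: u).
Proof.
case=> w ->; exists (fun i => a *: w i).
by rewrite scaler_sumr; apply: eq_bigr => i _; rewrite !scalerA mulrC.
Qed.

Lemma span_below_submod j : submod_pred (span_below j).
Proof.
by split; [apply: span_below0 | apply: span_belowD | apply: span_belowZ].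
Qed.

Lemma kscalarD k (u v : kchain V k) : kscalar (u + v) = kscalar u + kscalar v.
Proof. by elim: k u v => [|k IH] u v //=; rewrite IH. Qed.

Lemma kscalarZ k a (u : kchain V k) : kscalar (a *: u) = a *: kscalar u.
Proof. by elim: k u => [|k IH] u //=; rewrite IH. Qed.

Lemma kscalar_kinj k v : kscalar (kinj k v : kchain V k) = v.
Proof. by elim: k => [|k IH] //=. Qed.

Lemma kdiff_kinj k v : kdiff (kinj k v : kchain V k) = 0.
Proof. by elim: k => [|k IH] //=; rewrite IH !linear0 addr0. Qed.

Lemma kall_kscalar (P : V -> Prop) k (c : kchain V k) : kall P c -> P (kscalar c).
Proof. by elim: k c => [|k IH] c //= [/IH]. Qed.

Lemma kall_kinj (P : V -> Prop) k v : P 0 -> P v -> kall P (kinj k v : kchain V k).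
Proof.
move=> P0 Pv; elim: k => [|k IH] //=; split=> //.
by elim: {IH} k => [|k IH] //=.
Qed.

Lemma span_belowS j v : span_below j v -> span_below j.+1 v.
Proof.
case=> w ->; exists (fun i => if i == j then 0 else w i).
rewrite big_ord_recr /= eqxx scaler0 addr0; apply: eq_bigr => i _.
by rewrite ltn_eqF.
Qed.

Lemma span_below_kdiff k (c : kchain V k) : span_below k (kscalar (kdiff c)).
Proof.
elim: k c => [|k IH] /=; first by move=> _; apply: span_below0.
case=> c1 c2 /=; rewrite kscalarD kscalarZ; apply: span_belowD; first exact/span_belowS/IH.
exists (fun i => if i == k then kscalar c2 else 0).
rewrite big_ord_recr /= eqxx big1 ?add0r // => i _.
by rewrite ltn_eqF // scaler0.
Qed.

(** Koszul complexes of regular sequences are exact in positive exterior degree.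
    The hypothesis on [kscalar c] handles degree zero in the same statement,
    where the homology is [V] modulo the sequence. *)
Theorem koszul_exact k (c : kchain V k) :
    (forall j v, (j < k)%N -> span_below j (x j *: v) -> span_below j v) ->
  kdiff c = 0 -> span_below k (kscalar c) -> exists u, c = kdiff u.
Proof.
elim: k c => [|k IH] c reg /=.
  by move=> _ [w ->]; exists 0; rewrite big_ord0.
have /IH{}IH : forall j v, (j < k)%N -> span_below j (x j *: v) -> span_below j v.
  by move=> j v /ltnW; apply: reg.
case: c => a b /= [] da /eqP; rewrite oppr_eq0 => /eqP db [w a0].
have [b' def_b] : exists b', b = kdiff b'.
  apply: IH => //; apply: reg => //.
  have ->: x k *: kscalar b = - 1 *: kscalar (kdiff a).
    rewrite -!kscalarZ; congr kscalar; apply/eqP.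
    by rewrite scaleN1r -addr_eq0 addrC da.
  exact/span_belowZ/span_below_kdiff.
(* A term of exterior degree zero, a cycle, corrects [b'] so that the sum has
   its scalar part in the span of the first [k] elements. *)
have [w' def_a] : exists a', a + x k *: (b' - kinj k (w k + kscalar b')) = kdiff a'.
  apply: IH.
    by rewrite linearD linearZ linearB /= kdiff_kinj subr0 -def_b da.
  rewrite kscalarD kscalarZ -scaleN1r kscalarD kscalarZ kscalar_kinj a0.
  rewrite scaleN1r opprD addrCA subrr addr0 big_ord_recr /= -addrA.
  by rewrite -scalerDr subrr scaler0 addr0; exists w.
exists (w', - (b' - kinj k (w k + kscalar b'))) => /=.
rewrite -def_a scalerN addrK; congr (_, _).
by rewrite linearN linearB /= kdiff_kinj subr0 opprK.
Qed.

End Differential.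

(** The two maps [f] and [g] are equal when [f] is linear; they are consecutive
    homogeneous projections when the chain is cut into its graded pieces. *)
Lemma kmap_kdiff (V W : lmodType R) (f : {additive V -> W}) (g : V -> W) k
    (c : kchain V k) :
    (forall j v, (j < k)%N -> f (x j *: v) = x j *: g v) ->
  kmap f (kdiff c) = kdiff (kmap g c).
Proof.
elim: k c => [|k IH] /=; first by move=> _ _; rewrite raddf0.
case=> c1 c2 fg /=; have fgk j v : (j < k)%N -> f (x j *: v) = x j *: g v.
  by move/ltnW; apply: fg.
rewrite (raddfD (@kmap V W f k)) (raddfN (@kmap V W f k)) /=.
rewrite !(IH _ fgk).
by rewrite (@kmap_scale _ _ f g) // => v; apply: fg.
Qed.

End KoszulDifferential.
End KoszulChains.

(** * Regularity through Koszul homology *)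

Section KoszulRegularity.
Variables (K : fieldType) (m : nat).
Local Notation S := {mpoly K[m]}.
Local Notation hom t := (fun p : S => p \is t.-homog).

Local Notation kallS := (@kall _ S^o).

(** The Koszul complex takes a sequence indexed by [nat], so the variables are
    extended by zero. *)
Definition var_seq (j : nat) : S := if insub j is Some i then 'X_i else 0.

Lemma var_seqE (i : 'I_m) : var_seq i = 'X_i.
Proof. by rewrite /var_seq valK. Qed.

Lemma pihomogXM t i (p : S) :
  pihomog mdeg t ('X_i * p) = if t is t'.+1 then 'X_i * pihomog mdeg t' p else 0.
Proof.
rewrite [p in LHS]mpolyE mulr_sumr raddf_sum /=.
transitivity (\sum_(u <- msupp p) if t is t'.+1 then
    'X_i * pihomog mdeg t' (p@_u *: 'X_[u]) else 0).
  apply: eq_bigr => u _; rewrite -scalerAr linearZ /= -mpolyXD pihomogX.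
  rewrite /= mdegD mdeg1; case: t => [|t]; first by rewrite scaler0.
  rewrite linearZ /= pihomogX add1n eqSS; case: eqP => _.
    by rewrite -scalerAr mpolyXD.
  by rewrite !scaler0 mulr0.
case: t => [|t]; first by rewrite big1.
by rewrite -mulr_sumr -raddf_sum -mpolyE.
Qed.

Definition graded_ideal (I : S -> Prop) : Prop :=
  submod_pred (I : S^o -> Prop) /\ forall t p, I p -> I (pihomog mdeg t p).

(** A Koszul chain of exterior degree [i] and internal degree [j] has
    coefficients of degree [t = j - i], so this says [H_i(x; S/I)_j = 0] as soon
    as [j - i > r], for all [i] at once. *)
Definition koszul_reg_le (I : S -> Prop) (r : nat) : Prop :=
  forall t (c : kchain S^o m), (r < t)%N -> kallS (hom t) c ->
  kallS I (kdiff var_seq c) -> exists u, kallS I (c - kdiff var_seq u).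

Lemma koszul_reg_leW I r s : (r <= s)%N -> koszul_reg_le I r -> koszul_reg_le I s.
Proof. by move=> le_rs reg t c lt_st; apply: reg; apply: leq_ltn_trans lt_st. Qed.

Lemma koszul_reg_eq I I' r : (forall f, I f <-> I' f) ->
  koszul_reg_le I r -> koszul_reg_le I' r.
Proof.
move=> eqI reg t c lt_rt hc I'dc; have [||u Iu] := reg t c lt_rt.
- exact: hc.
- by apply: kall_imp I'dc => f /eqI.
- by exists u; apply: kall_imp Iu => f /eqI.
Qed.

Lemma in_irrelevant (I : S -> Prop) f :
    submod_pred (I : S^o -> Prop) -> (forall i : 'I_m, I 'X_i) ->
  f@_0%MM = 0 -> I f.
Proof.
move=> subI IX f0; rewrite (mpolyE f) big_seq.
apply: (big_ind I) => [|p q|u uf]; first exact: (submod0 subI).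
  exact: (submodD subI).
have u0 : u != 0%MM by apply: contraTneq uf => ->; rewrite mcoeff_msupp f0 eqxx.
have [i ui] : exists i, (0 < u i)%N.
  apply/existsP; apply: contraNT u0; rewrite negb_exists => /forallP u0.
  by apply/eqP/mnmP => i; have := u0 i; rewrite -leqNgt leqn0 mnm0E => /eqP.
have leU : (U_(i) <= u)%MM by rewrite lep1mP -lt0n.
by rewrite -(submK leU) mpolyXD scalerAl; apply: (submodZ subI) (IX i).
Qed.

(** The Koszul homology of the residue field is the exterior algebra itself,
    whose coefficients are constants. *)
Lemma koszul_reg_irrelevant (I : S -> Prop) :
    submod_pred (I : S^o -> Prop) -> (forall i : 'I_m, I 'X_i) ->
  koszul_reg_le I 0.
Proof.
move=> subI IX t c t0 hc _; exists 0; rewrite linear0 subr0.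
apply: kall_imp hc => f hf; apply: in_irrelevant => //.
by apply: dhomog_nemf_coeff hf _; rewrite /= mdeg0 eq_sym -lt0n.
Qed.

(** For a nonzerodivisor ['X_i] modulo [I], multiplication by ['X_i] is zero on
    Koszul homology, so the homology of [S/I] embeds into that of
    [S/(I, 'X_i)]. *)
Lemma koszul_reg_nzd (I I' : S -> Prop) (i : 'I_m) r :
    submod_pred (I : S^o -> Prop) ->
    (forall f, I f -> I' f) ->
    (forall f, I' f -> exists g h, I g /\ f = g + 'X_i * h) ->
    (forall f, I ('X_i * f) -> I f) ->
  koszul_reg_le I' r -> koszul_reg_le I r.
Proof.
move=> subI subII' decI' nzd reg t c lt_rt hc Idc.
have subC := kall_submod m subI.
have [u I'u] : exists u, kallS I' (c - kdiff var_seq u).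
  by apply: (reg t) => //; apply: kall_imp Idc.
have [|a [b [Ia Xb cE]]] := kall_split (V := S^o) (P1 := I)
    (P2 := fun f : S^o => exists h : S^o, f = ('X_i : S) *: h) _ I'u.
  by move=> f /decI'[g [h [Ig ->]]]; exists g, ('X_i * h); split=> //; exists h.
have {Xb} [w b_w] := kall_lift (V := S^o) (fun _ => id) Xb.
rewrite kmap_scaler in b_w; subst b.
have Idw : kallS I (kdiff var_seq w).
  apply: (kall_imp (V := S^o) nzd); apply: (@kall_kmapK _ S^o S^o).
  rewrite kmap_scaler.
  have ->: ('X_i : S) *: kdiff var_seq w = kdiff var_seq c - kdiff var_seq a.
    apply: canRL (addrK _) _; rewrite addrC -linearZ -linearD -cE linearB /=.
    by rewrite kdiff_kdiff subr0.
  by apply: (submodB subC) => //; apply: kall_kdiff.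
(* ['X_i *: w] is the boundary of [kwedge i w] up to [kwedge i (kdiff w)]. *)
exists (u + kwedge i w); rewrite linearD /= opprD addrA cE -addrA.
rewrite -var_seqE -(kdiff_kwedge _ _ (ltn_ord i)) addrAC subrr add0r.
by apply: (submodD subC) => //; apply: kall_kwedge.
Qed.

Lemma kmap_pihomog_kdiff t (c : kchain S^o m) :
  kmap (V := S^o) (W := S^o) (pihomog mdeg t.+1) (kdiff var_seq c) =
  kdiff var_seq (kmap (V := S^o) (W := S^o) (pihomog mdeg t) c).
Proof.
apply: (@kmap_kdiff _ _ S^o S^o) => j v ltjm.
by rewrite (var_seqE (Ordinal ltjm)) /GRing.scale /= pihomogXM.
Qed.

Lemma kmap_pihomog_id t (c : kchain S^o m) : kallS (hom t) c ->
  kmap (V := S^o) (W := S^o) (pihomog mdeg t) c = c.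
Proof.
by move=> hc; apply: kmap_eq_id; apply: kall_imp hc => f /pihomog_dE.
Qed.

(** The bounding chain may be cut down to its homogeneous part. *)
Lemma koszul_reg_homog (I : S -> Prop) r t (c : kchain S^o m) :
    graded_ideal I -> koszul_reg_le I r -> (r < t.+1)%N ->
    kallS (hom t.+1) c -> kallS I (kdiff var_seq c) ->
  exists u, kallS (hom t) u /\ kallS I (c - kdiff var_seq u).
Proof.
move=> [subI grI] reg lt_rt hc /(reg _ _ lt_rt hc)[u Iu].
exists (kmap (V := S^o) (W := S^o) (pihomog mdeg t) u); split.
  apply: (kall_kmap (V := S^o) (P := fun=> True)) => [v _|]; first exact: pihomogP.
  exact: kall_forall.
rewrite -kmap_pihomog_kdiff -{1}(kmap_pihomog_id hc) -raddfB /=.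
by apply: kall_kmap Iu; apply: grI.
Qed.

(** The long exact sequence of
    [0 -> S/(I1 :&: I2) -> S/I1 (+) S/I2 -> S/(I1 + I2) -> 0]: the connecting
    map into the homology of [S/(I1 :&: I2)] lowers the exterior degree by one,
    hence raises the degree of the coefficients by one. *)
Lemma koszul_reg_cap (I I1 I2 I12 : S -> Prop) r :
    graded_ideal I1 -> graded_ideal I2 ->
    (forall f, I1 f -> I2 f -> I f) ->
    (forall f, I f -> I1 f /\ I2 f) ->
    (forall f, I1 f \/ I2 f -> I12 f) -> submod_pred (I12 : S^o -> Prop) ->
    (forall f, I12 f -> exists f1 f2, [/\ I1 f1, I2 f2 & f = f1 + f2]) ->
    koszul_reg_le I1 r.+1 -> koszul_reg_le I2 r.+1 -> koszul_reg_le I12 r ->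
  koszul_reg_le I r.+1.
Proof.
move=> gr1 gr2 capI subI sumI sub12 decI reg1 reg2 reg12 [//|t] c lt_rt hc Idc.
have [sI1 _] := gr1; have [sI2 _] := gr2.
have subC1 := kall_submod m sI1; have subC2 := kall_submod m sI2.
have [u1 [hu1 Iu1]] : exists u, kallS (hom t) u /\ kallS I1 (c - kdiff var_seq u).
  by apply: (koszul_reg_homog gr1 reg1) => //; apply: kall_imp Idc => f /subI[].
have [u2 [hu2 Iu2]] : exists u, kallS (hom t) u /\ kallS I2 (c - kdiff var_seq u).
  by apply: (koszul_reg_homog gr2 reg2) => //; apply: kall_imp Idc => f /subI[].
(* The connecting map: [u1 - u2] is a cycle modulo the sum. *)
have [w Iw] : exists w, kallS I12 (u1 - u2 - kdiff var_seq w).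
  apply: (reg12 t) => //.
    have /= := kall_kmap (V := S^o) (W := S^o) (f := pihomog mdeg t) (Q := hom t)
      (P := fun=> True) (c := u1 - u2) (fun v _ => pihomogP _ _ v).
    rewrite raddfB /= !kmap_pihomog_id //; apply.
    exact: kall_forall.
  rewrite linearB /=.
  have ->: kdiff var_seq u1 - kdiff var_seq u2 =
     (c - kdiff var_seq u2) - (c - kdiff var_seq u1).
    by rewrite opprB [RHS]addrC addrA subrK.
  apply: (submodB (kall_submod m sub12)); [apply: kall_imp Iu2|apply: kall_imp Iu1].
    by move=> f I2f; apply: sumI; right.
  by move=> f I1f; apply: sumI; left.
have [a [b [I1a I2b wE]]] := kall_split (V := S^o) decI Iw.
have u'E : u1 - kdiff var_seq w - a = u2 + b.
  apply/eqP; rewrite !subr_eq -(addrA u2) [b + a]addrC -wE addrA subrK addrC.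
  by rewrite subrK.
exists (u2 + b); suff [c1 c2] : kallS I1 (c - kdiff var_seq (u2 + b)) /\
   kallS I2 (c - kdiff var_seq (u2 + b)).
  exact: (kall_imp2 (V := S^o) capI) c1 c2.
split.
  rewrite -u'E !linearB /= kdiff_kdiff !opprK addr0 addrA.
  by apply: (submodD subC1) => //; apply: kall_kdiff.
rewrite linearD /= opprD addrA.
by apply: (submodB subC2) => //; apply: kall_kdiff.
Qed.
End KoszulRegularity.

(** * Killing variables; Koszul homology of free modules *)

Section KillVariables.
Variables (K : fieldType) (m : nat).
Local Notation S := {mpoly K[m]}.

Definition kill_tuple (Z : pred 'I_m) : m.-tuple S :=
  [tuple if Z i then 0 else 'X_i | i < m].
Local Notation kill Z := (comp_mpoly (kill_tuple Z)).

Lemma mpolyX_neq0 (u : 'X_{1..m}) : 'X_[u] != 0 :> S.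
Proof.
apply/eqP => /(congr1 (mcoeff u)) /eqP.
by rewrite mcoeffX mcoeff0 eqxx oner_eq0.
Qed.

Lemma killX Z i : kill Z 'X_i = if Z i then 0 else 'X_i.
Proof. by rewrite comp_mpolyXU -tnth_nth tnth_mktuple. Qed.

(** Killing the variables of [Z] changes a polynomial by an element of the ideal
    they generate. *)
Lemma sub_kill (P : S -> Prop) (Z : pred 'I_m) p :
    submod_pred (P : S^o -> Prop) -> (forall i, Z i -> P 'X_i) ->
  P (p - kill Z p).
Proof.
move=> subP PX; elim/mpolyind: p => [|a u p _ _ IH].
  by rewrite raddf0 subr0; apply: (submod0 subP).
rewrite raddfD /= opprD addrACA; apply: (submodD subP) IH.
rewrite linearZ /= -scalerBr -mul_mpolyC; apply: (submodZ subP (a%:MP)).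
rewrite mpolyXE_id rmorph_prod /=.
apply: (big_rec2 (fun q1 q2 => P (q2 - q1))).
  by rewrite subrr; apply: (submod0 subP).
move=> i q1 q2 _ Pq; rewrite rmorphXn /=.
have ->: 'X_i ^+ u i * q2 - kill Z 'X_i ^+ u i * q1 =
   'X_i ^+ u i * (q2 - q1) + q1 * ('X_i ^+ u i - kill Z 'X_i ^+ u i).
  by rewrite !mulrBr [q1 * _]mulrC [q1 * _]mulrC addrA subrK.
apply: (submodD subP (submodZ subP _ Pq)); apply: (submodZ subP q1).
rewrite killX; case: ifP => Zi; last by rewrite subrr; apply: (submod0 subP).
case: (u i) => [|e]; first by rewrite subrr; apply: (submod0 subP).
by rewrite expr0n subr0 exprSr; apply: (submodZ subP ('X_i ^+ e)) (PX _ Zi).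
Qed.

End KillVariables.

Section FreeModules.
Variables (K : fieldType) (m : nat).
Local Notation S := {mpoly K[m]}.
Local Notation kill Z := (comp_mpoly (kill_tuple K Z)).
Local Notation x := (@var_seq K m).

Lemma span_below_row N j (v : 'rV[S]_N) :
  (forall k, span_below x j (v 0 k : S^o)) -> span_below x j v.
Proof.
move=> /fin_all_exists[w wE]; exists (fun i => \row_k w k i).
apply/rowP => k; rewrite wE summxE; apply: eq_bigr => i _.
by rewrite !mxE.
Qed.

Lemma span_below_entry N j (v : 'rV[S]_N) k :
  span_below x j v -> span_below x j (v 0 k : S^o).
Proof.
case=> w ->; exists (fun i => w i 0 k).
by rewrite summxE; apply: eq_bigr => i _; rewrite mxE.
Qed.

Lemma span_below_var j (p : S) : 
  span_below x j (p : S^o) <-> kill (fun i : 'I_m => i < j)%N p = 0.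
Proof.
split=> [[w ->]|kp].
  rewrite raddf_sum big1 // => i _; rewrite /GRing.scale /= rmorphM /= /var_seq.
  case: insubP => [i' _ i'E|_]; last by rewrite raddf0 mul0r.
  by rewrite killX /= i'E ltn_ord mul0r.
rewrite -[p]subr0 -kp; apply: sub_kill; first exact: span_below_submod.
move=> i lij; exists (fun k => (k == i :> nat)%:R).
rewrite (bigD1 (Ordinal lij)) //= eqxx var_seqE /GRing.scale /= mulr1.
rewrite big1 ?addr0 // => k; rewrite -val_eqE /= => /negPf->.
by rewrite mulr0.
Qed.

(** The variables form a regular sequence on a free module: modulo the first
    [j] of them, ['X_j] acts on polynomials in the remaining variables. *)
Lemma var_regular N j (v : 'rV[S]_N) : (j < m)%N ->
  span_below x j (x j *: v) -> span_below x j v.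
Proof.
move=> ltjm xv; apply: span_below_row => k; apply/span_below_var.
move: (span_below_entry k xv); rewrite mxE (var_seqE _ (Ordinal ltjm)).
move/span_below_var; rewrite rmorphM /= killX /= ltnn => /eqP.
by rewrite mulf_eq0 (negPf (mpolyX_neq0 K _)) => /eqP.
Qed.

Lemma span_below_const N (v : 'rV[S]_N) :
  span_below x m v <-> forall k, (v 0 k)@_0%MM = 0.
Proof.
split=> [vm k|v0].
  have [w ->] := span_below_entry k vm; rewrite raddf_sum big1 // => i _.
  by rewrite /GRing.scale /= rmorphM /= var_seqE mcoeffX -mdeg_eq0 mdeg1 mul0r.
apply: span_below_row => k; apply: in_irrelevant (v0 k).
  exact: span_below_submod.
move=> i; exists (fun j => (j == i :> nat)%:R).
rewrite (bigD1 i) //= eqxx var_seqE /GRing.scale /= mulr1.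
rewrite big1 ?addr0 // => j; rewrite -val_eqE /= => /negPf->.
by rewrite mulr0.
Qed.

End FreeModules.

(** * Minimal resolutions and Koszul homology *)

Section MinimalResolution.
Variables (K : fieldType) (m : nat) (F : free_complex K m).
Local Notation S := {mpoly K[m]}.
Local Notation x := (@var_seq K m).
Local Notation Fm i := 'rV[S]_(grank F i).

Definition augment (u : (Fm 0)) : S^o := (u *m gaug F) 0 0.

Lemma augmentB u v : augment (u - v) = augment u - augment v.
Proof. by rewrite /augment mulmxBl !mxE. Qed.

HB.instance Definition _ := GRing.isZmodMorphism.Build _ _ augment augmentB.

Lemma augmentZ a u : augment (a *: u) = a *: augment u.
Proof. by rewrite /augment -scalemxAl mxE. Qed.

Definition weight_hom i T (v : (Fm i)) : Prop :=
  forall k, shift_homog T (gdeg k) (v 0 k).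

(** Projection of the free module [F_i], whose [k]-th generator has degree
    [gdeg k], onto its component of degree [T]. *)
Definition weight_part i T (v : (Fm i)) : (Fm i) :=
  \row_k (if (gdeg k <= T)%N then pihomog mdeg (T - gdeg k) (v 0 k) else 0).

Lemma weight_partB i T (u v : (Fm i)) :
  weight_part T (u - v) = weight_part T u - weight_part T v.
Proof.
by apply/rowP => k; rewrite !mxE; case: ifP => _; rewrite ?raddfB ?subr0.
Qed.

HB.instance Definition _ i T :=
  GRing.isZmodMorphism.Build _ _ (@weight_part i T) (@weight_partB i T).

Lemma weight_partP i T (v : (Fm i)) : weight_hom T (weight_part T v).
Proof.
by move=> k; rewrite /shift_homog mxE; case: ifP => lek; rewrite ?lek ?pihomogP.
Qed.

Lemma weight_part_id i T (v : (Fm i)) : weight_hom T v -> weight_part T v = v.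
Proof.
move=> hv; apply/rowP => k; rewrite mxE; move: (hv k); rewrite /shift_homog.
by case: ifP => _; [apply: pihomog_dE | move/eqP].
Qed.

Lemma weight_partX i T j (v : (Fm i)) : (j < m)%N ->
  weight_part T.+1 (x j *: v) = x j *: weight_part T v.
Proof.
move=> ltjm; apply/rowP => k; rewrite !mxE (var_seqE K (Ordinal ltjm)).
rewrite pihomogXM leq_eqVlt ltnS; case: eqP => [->|_] /=.
  by rewrite subnn ltnn mulr0.
by case: leqP => [leT|]; rewrite ?subSn // mulr0.
Qed.

Lemma shift_homogM a b c (p q : S) :
  shift_homog a b p -> shift_homog b c q -> shift_homog a c (p * q).
Proof.
rewrite /shift_homog; case: leqP => [leba hp|_ /eqP-> _]; last first.
  by rewrite mul0r; case: ifP => _ //; apply: dhomog0.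
case: leqP => [lecb hq|_ /eqP->]; last first.
  by rewrite mulr0; case: ifP => _ //; apply: dhomog0.
by rewrite (leq_trans lecb leba) -(subnK leba) -addnBA //; apply: dhomogM.
Qed.

Lemma shift_homog_sum a c (I : finType) (f : I -> S) :
  (forall k, shift_homog a c (f k)) -> shift_homog a c (\sum_k f k).
Proof.
rewrite /shift_homog; case: ifP => _ h; first by apply: rpred_sum => k _; apply: h.
by rewrite big1 // => k _; apply/eqP.
Qed.

Hypothesis grF : is_graded F.

Lemma augment_homog T (u : (Fm 0)) : weight_hom T u -> augment u \is T.-homog.
Proof.
move=> hu; have [gr0 _] := grF.
suff: shift_homog T 0 (augment u) by rewrite /shift_homog leq0n subn0.
by rewrite /augment mxE; apply: shift_homog_sum => k; apply: shift_homogM (hu k) (gr0 k).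
Qed.

Lemma gdiff_homog i T (u : (Fm i.+1)) :
  weight_hom T u -> weight_hom T (u *m gdiff F i).
Proof.
move=> hu k; have [_ gr] := grF; rewrite mxE; apply: shift_homog_sum => l.
exact: shift_homogM (hu l) (gr i l k).
Qed.

Definition syzygy i (u : (Fm i)) : Prop := exists v, u = v *m gdiff F i.

Lemma syzygy_submod i : submod_pred (@syzygy i).
Proof.
split=> [|u v [u' ->] [v' ->]|a u [u' ->]].
- by exists 0; rewrite mul0mx.
- by exists (u' + v'); rewrite mulmxDl.
- by exists (a *: u'); rewrite -scalemxAl.
Qed.

Variables (J : S -> Prop) (r : nat).
Hypotheses (subJ : submod_pred (J : S^o -> Prop)) (resF : resolves F J).
Hypotheses (minF : is_minimal F) (regJ : koszul_reg_le J r).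

(** The module [F_0] modulo its first syzygies is [S/J], so the vanishing carries
    over through the augmentation. *)
Lemma syzygy_koszul_vanishing0 T (c : kchain (Fm 0) m) : (r < T)%N ->
    kall (@weight_hom 0 T) c -> kall (@syzygy 0) (kdiff x c) ->
  exists u, kall (@syzygy 0) (c - kdiff x u).
Proof.
move=> ltrT hc imdc; have [sur ker0 _] := resF.
have subC := kall_submod m subJ.
have augX k (d : kchain (Fm 0) k) : kmap augment (kdiff x d) = kdiff x (kmap augment d).
  by apply: kmap_kdiff => j v _; apply: augmentZ.
have [w Jw] : exists w, kall (V := S^o) J (kmap augment c - kdiff x w).
  apply: (regJ ltrT); first by apply: kall_kmap hc; apply: augment_homog.
  by rewrite -augX; apply: kall_kmap imdc => v /ker0.
have [||_ [b [/(kall_lift (fun _ => id))[u ->] Jb wE]]] :=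
    @kall_split _ S^o (fun=> True) (fun p => exists u, p = augment u) J m w.
- move=> p _; have [u Ju] := sur p.
  exists (augment u), (p - augment u); split=> //; first by exists u.
  by rewrite addrC subrK.
- exact: kall_forall.
exists u; apply: (kall_imp (P := fun v => J (augment v))) => [v /ker0 //|].
apply: (@kall_kmapK _ _ S^o J augment).
rewrite raddfB /= augX.
have -> : kmap augment u = w - b by rewrite wE addrK.
rewrite linearB /= opprB addrCA addrC.
by apply: (submodD subC) => //; apply: kall_kdiff.
Qed.

(** Dimension shifting along [0 -> M_(i+1) -> F_i -> M_i -> 0], where [M_i] is
    the cokernel of [F_(i+1) -> F_i]: a class of [M_(i+1)] in exterior degree [p]
    comes from a class of [M_i] in exterior degree [p + 1] and the same internal
    degree, hence of weight one less.  The case [p = 0] needs minimality. *)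
Lemma syzygy_koszul_vanishing i T (c : kchain (Fm i) m) : (i + r < T)%N ->
    kall (@weight_hom i T) c -> kall (@syzygy i) (kdiff x c) ->
  exists u, kall (@syzygy i) (c - kdiff x u).
Proof.
elim: i T c => [|i IH] [//|T] c; first exact: syzygy_koszul_vanishing0.
rewrite addSn ltnS => ltT hc imdc; have [_ _ ker] := resF.
pose D := mulmxr (gdiff F i) : {additive (Fm i.+1) -> (Fm i)}.
have DX k (d : kchain (Fm i.+1) k) : kmap D (kdiff x d) = kdiff x (kmap D d).
  by apply: kmap_kdiff => j v _; rewrite /D /= scalemxAl.
(* The image of the cycle [c] bounds on the free module [F_i]: in exterior
   degree zero its constant term vanishes by minimality. *)
have [b bE] : exists b, kmap D c = kdiff x b.
  apply: koszul_exact => [j v||]; first exact: var_regular.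
    rewrite -DX; apply/kall_eq0; apply: kall_kmap imdc => v /ker.
    by [].
  have -> : kscalar (kmap D c) = kscalar c *m gdiff F i.
    exact: kscalar_kmap.
  apply/span_below_const => k; rewrite mxE raddf_sum big1 // => l _.
  by rewrite /= rmorphM /= minF mulr0.
(* Projecting [b] makes it homogeneous, so that induction applies. *)
have {}bE : kmap D c = kdiff x (kmap (@weight_part i T) b).
  rewrite -(@kmap_kdiff _ _ _ _ (@weight_part i T.+1)) => [|j v]; last first.
    exact: weight_partX.
  rewrite -bE kmap_eq_id //.
  refine (kall_kmap (f := D) _ hc) => v hv.
  by apply: weight_part_id; apply: gdiff_homog.
have [||u] := IH T (kmap (@weight_part i T) b) ltT.
- apply: (kall_kmap (P := fun=> True)) => [v _|]; first exact: weight_partP.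
  exact: kall_forall.
- rewrite -bE.
  refine (kall_kmap (P := fun=> True) (f := D) (fun v _ => _) _); last first.
    exact: kall_forall.
  by exists v.
case/(kall_lift (f := D)) => [v [w ->]|c' c'E]; first by exists w.
exists c'; apply: (kall_imp (P := fun v => D v = 0)) => [v /ker //|].
apply: (kall_kmapK (Q := fun v => v = 0) (f := D)); apply/kall_eq0.
rewrite raddfB /= DX -c'E bE.
by rewrite linearB /= kdiff_kdiff subr0 subrr.
Qed.

(** A basis vector of [F_i] is a Koszul cycle of exterior degree zero.  If its
    degree were too large it would be a boundary modulo the syzygies, and both
    boundaries and syzygies have zero constant terms. *)
Lemma koszul_reg_gdeg i (k : 'I_(grank F i)) : (gdeg k <= i + r)%N.
Proof.
rewrite leqNgt; apply/negP => lt_deg.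
pose e : Fm i := delta_mx 0 k.
have [||u im_e] := @syzygy_koszul_vanishing i (gdeg k) (kinj m e) lt_deg.
- apply: kall_kinj => l; rewrite /shift_homog mxE.
    by case: ifP => _ //; apply: dhomog0.
  rewrite eqxx; case: eqP => [->|_]; first by rewrite leqnn subnn dhomog1.
  by case: ifP => _ //; apply: dhomog0.
- by rewrite kdiff_kinj; apply: submod0 (kall_submod m (syzygy_submod i)).
have [v] := kall_kscalar im_e.
rewrite -scaleN1r kscalarD kscalarZ kscalar_kinj scaleN1r.
move/(congr1 (fun w : Fm i => (w 0 k)@_0%MM)).
rewrite !mxE !eqxx mcoeffB mcoeff1 eqxx.
have /span_below_const-> := span_below_kdiff x u.
rewrite raddf_sum big1 => [|l _]; last by rewrite /= rmorphM /= minF mulr0.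
by move/eqP; rewrite subr0 oner_eq0.
Qed.

End MinimalResolution.

Theorem koszul_reg_quotient (K : fieldType) m (J : {mpoly K[m]} -> Prop) r :
    submod_pred (J : {mpoly K[m]}^o -> Prop) ->
  koszul_reg_le J r -> reg_quotient_le J r.
Proof.
move=> subJ regJ F [grF resF minF] i j.
rewrite /betti => /eqP; rewrite -lt0n card_gt0 => /set0Pn[k].
rewrite inE => /eqP<-; rewrite Num.Theory.lerBlDl -PoszD lez_nat.
exact: (koszul_reg_gdeg grF subJ resF minF regJ).
Qed.

(** * Ideals generated by variables and edge binomials *)

Section Span.
Variables (K : fieldType) (m : nat).
Local Notation S := {mpoly K[m]}.

(** The ideal generated by an arbitrary predicate; the inductive form avoids
    indexing the generators by a finite type. *)
Inductive ideal_span (B : S -> Prop) : S -> Prop :=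
| span_zero : ideal_span B 0
| span_cons a g f : B g -> ideal_span B f -> ideal_span B (a * g + f).

Lemma span_gen (B : S -> Prop) g : B g -> ideal_span B g.
Proof.
by move=> Bg; rewrite -[g]mul1r -[1 * g]addr0; apply: span_cons (span_zero B).
Qed.

Lemma span_submod (B : S -> Prop) : submod_pred (ideal_span B : S^o -> Prop).
Proof.
split=> [|u v su sv|a u su]; first exact: span_zero.
  by elim: su => [|b g f Bg _ IH]; rewrite ?add0r // -addrA; apply: span_cons.
elim: su => [|b g f Bg _ IH]; first by rewrite scaler0; apply: span_zero.
by rewrite /GRing.scale /= mulrDr mulrA; apply: span_cons.
Qed.

Lemma span_sub (B P : S -> Prop) : submod_pred (P : S^o -> Prop) ->
  (forall g, B g -> P g) -> forall f, ideal_span B f -> P f.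
Proof.
move=> subP BP f; elim=> [|a g h Bg _ Ph]; first exact: (submod0 subP).
by apply: (submodD subP) Ph; apply: (submodZ subP a) (BP _ Bg).
Qed.

Lemma span_graded (B : S -> Prop) :
  (forall g, B g -> exists d, g \is d.-homog) -> graded_ideal (ideal_span B).
Proof.
move=> homB; have sB := span_submod B; split=> // t f sf.
suff subP : submod_pred ((fun p => forall t, ideal_span B (pihomog mdeg t p)) : S^o -> Prop).
  move: f sf t; apply: (span_sub subP) => g Bg t; have [d hg] := homB _ Bg.
  have [<-|ne_dt] := eqVneq d t; first by rewrite pihomog_dE //; apply: span_gen.
  by rewrite (pihomog_ne0 ne_dt hg); apply: span_zero.
split=> [|u v su sv|a u su] s; first by rewrite raddf0; apply: span_zero.
  by rewrite raddfD; apply: (submodD sB) (su s) (sv s).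
rewrite /GRing.scale /=; elim/mpolyind: a s => [|c w a _ _ IH] s.
  by rewrite mul0r raddf0; apply: span_zero.
rewrite mulrDl raddfD; apply: (submodD sB) (IH s).
rewrite /= -scalerAl linearZ /= -mul_mpolyC; apply: (submodZ sB c%:MP).
rewrite mpolyXE_id; elim/big_rec: _ s => [|i q _ IHq] s.
  by rewrite mul1r; apply: su.
rewrite -mulrA; elim: (w i) s => [|e IHe] s; first by rewrite mul1r; apply: IHq.
rewrite exprS -mulrA pihomogXM; case: s => [|s]; first exact: span_zero.
exact: (submodZ sB 'X_i).
Qed.

Local Notation kill Z := (comp_mpoly (kill_tuple K Z)).

(** The principle behind Ohtani's decomposition.  Setting the variables of [Z] to
    zero maps [B2] back into the ideal of [B]; on the ideal of [B1] it changes
    an element by a multiple of some [z] in [Z], and such multiples lie in the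
    ideal of [B]. *)
Lemma span_cap (B B1 B2 : S -> Prop) (Z : pred 'I_m) h :
    (forall g, B g -> ideal_span B (kill Z g)) ->
    (forall g, B1 g -> ideal_span B (g - kill Z g)) ->
    (forall g z, B1 g -> Z z -> ideal_span B ('X_z * g)) ->
    (forall g, B2 g -> B g \/ exists2 z, Z z & g = 'X_z) ->
  ideal_span B1 h -> ideal_span B2 h -> ideal_span B h.
Proof.
move=> killB killB1 ZB1 B2P B1h B2h; have sB := span_submod B.
suff: ideal_span B (h - kill Z h) /\ ideal_span B (kill Z h).
  by case=> /(submodD sB) D /D; rewrite subrK.
split.
  elim: B1h => [|a g f Bg _ IH]; first by rewrite raddf0 subr0; apply: span_zero.
  rewrite raddfD /= opprD addrACA; apply: (submodD sB) IH.
  rewrite rmorphM /=.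
  have ->: a * g - kill Z a * kill Z g =
      g * (a - kill Z a) + kill Z a * (g - kill Z g).
    by rewrite !mulrBr addrA [a * g]mulrC [_ * g]mulrC subrK.
  apply: (submodD sB); last by apply: (submodZ sB (kill Z a)) (killB1 _ Bg).
  apply: (@sub_kill _ _ (fun p => ideal_span B (g * p))) => [|i Zi].
    split=> [|p q sp sq|b p sp]; first by rewrite mulr0; apply: span_zero.
      by rewrite mulrDr; apply: (submodD sB).
    by rewrite /GRing.scale /= mulrCA; apply: (submodZ sB b).
  by rewrite mulrC; apply: ZB1.
elim: B2h => [|a g f /B2P Bg _ IH]; first by rewrite raddf0; apply: span_zero.
rewrite raddfD /= rmorphM; apply: (submodD sB) IH.
case: Bg => [/killB|[z Zz ->]]; first by apply: (submodZ sB).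
by rewrite /= killX Zz mulr0; apply: span_zero.
Qed.

End Span.

Section EdgeIdeals.
Variables (K : fieldType) (n : nat).
Local Notation S := {mpoly K[n + n]}.
Local Notation kill Z := (comp_mpoly (kill_tuple K Z)).
Local Notation xv := (@xvar K n).
Local Notation yv := (@yvar K n).
Local Notation xi := (@lshift n n).
Local Notation yi := (@rshift n n).
Implicit Types (G : rel 'I_n) (Z : {set 'I_(n + n)}).

Definition edge_binomial (i j : 'I_n) : S := xv i * yv j - xv j * yv i.

Inductive edge_gens G Z : S -> Prop :=
| gen_var z : z \in Z -> edge_gens G Z 'X_z
| gen_edge i j : G i j -> edge_gens G Z (edge_binomial i j).

Definition edge_ideal G Z : S -> Prop := ideal_span (edge_gens G Z).

Lemma edge_ideal_graded G Z : graded_ideal (edge_ideal G Z).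
Proof.
apply: span_graded => g [z _|i j _]; first by exists 1%N; rewrite dhomogX /= mdeg1.
exists 2; rewrite /edge_binomial /xvar /yvar -!mpolyXD.
by rewrite rpredB // dhomogX /= mdegD !mdeg1.
Qed.

Lemma edge_ideal_submod G Z : submod_pred (edge_ideal G Z : S^o -> Prop).
Proof. exact: span_submod. Qed.

Lemma edge_idealS G G' Z Z' f :
    (forall i j, G i j -> G' i j) -> Z \subset Z' ->
  edge_ideal G Z f -> edge_ideal G' Z' f.
Proof.
move=> sG /subsetP sZ; apply: span_sub; first exact: edge_ideal_submod.
by move=> g [z /sZ Zz|i j /sG Gij]; apply: span_gen; constructor.
Qed.

Lemma reg_edge_ideal_top G : koszul_reg_le (edge_ideal G setT) 0.
Proof.
apply: koszul_reg_irrelevant; first exact: edge_ideal_submod.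
by move=> i; apply: span_gen; constructor; rewrite inE.
Qed.

Lemma reg_edge_ideal_add_var G Z z r :
    (forall f, edge_ideal G Z ('X_z * f) -> edge_ideal G Z f) ->
  koszul_reg_le (edge_ideal G (z |: Z)) r -> koszul_reg_le (edge_ideal G Z) r.
Proof.
move=> nzd; apply: koszul_reg_nzd nzd; first exact: edge_ideal_submod.
  by move=> f; apply: edge_idealS => //; apply: subsetUr.
move=> f; elim=> [|a g h gens _ [p [q [Ip ->]]]].
  by exists 0, 0; rewrite mulr0 addr0; split=> //; apply: span_zero.
have subI := edge_ideal_submod G Z.
case: gens => [y|i j Gij].
  case/setU1P=> [->|Zy]; first by exists p, (a + q); split=> //; ring.
  exists (a * 'X_y + p), q; split; last by rewrite addrA.
  by apply: span_cons => //; constructor.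
exists (a * edge_binomial i j + p), q; split; last by rewrite addrA.
by apply: span_cons => //; constructor.
Qed.

Lemma reg_edge_ideal_cap G G1 Z Z1 (Y : {set 'I_(n + n)}) r :
    (forall i j, G i j -> G1 i j) -> Z \subset Z1 ->
    (forall g, edge_gens G Z g -> edge_ideal G Z (kill (mem Y) g)) ->
    (forall g, edge_gens G1 Z1 g -> edge_ideal G Z (g - kill (mem Y) g)) ->
    (forall g z, edge_gens G1 Z1 g -> z \in Y -> edge_ideal G Z ('X_z * g)) ->
    koszul_reg_le (edge_ideal G1 Z1) r.+1 ->
    koszul_reg_le (edge_ideal G (Y :|: Z)) r.+1 ->
    koszul_reg_le (edge_ideal G1 (Y :|: Z1)) r ->
  koszul_reg_le (edge_ideal G Z) r.+1.
Proof.
move=> sG sZ killB killB1 YB1.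
have sub12 := edge_ideal_submod G1 (Y :|: Z1).
have sub1 := edge_ideal_submod G1 Z1; have sub2 := edge_ideal_submod G (Y :|: Z).
apply: koszul_reg_cap => //; try exact: edge_ideal_graded.
- move=> f; apply: span_cap killB killB1 YB1 _ => g [z|i j Gij].
    by case/setUP=> [Yz|Zz]; [right; exists z | left; constructor].
  by left; constructor.
- move=> f If; split; first exact: edge_idealS If.
  by apply: edge_idealS If => //; apply: subsetUr.
- move=> f []; apply: edge_idealS => //; first exact: subsetUr.
  exact: setUS.
- move=> f; elim=> [|a g h gens _ [p [q [Ip Iq ->]]]].
    by exists 0, 0; rewrite addr0; split=> //; apply: span_zero.
  have [] : edge_ideal G1 Z1 g \/ edge_ideal G (Y :|: Z) g.
    case: gens => [z /setUP[Yz|Zz]|i j Gij].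
    + by right; apply: span_gen; constructor; rewrite inE Yz.
    + by left; apply: span_gen; constructor.
    + by left; apply: span_gen; constructor.
  + move=> Ig; exists (a * g + p), q; split; rewrite ?addrA //.
    by apply: (submodD sub1) Ip; apply: (submodZ sub1 a).
  + move=> Ig; exists p, (a * g + q); split; rewrite // 1?addrCA //.
    by apply: (submodD sub2) Iq; apply: (submodZ sub2 a).
Qed.

End EdgeIdeals.

(** * Variables are nonzerodivisors on disjoint unions of cliques *)

Section Toric.
Variables (K : fieldType) (n : nat) (lab : 'I_n -> 'I_n).
Variable Z : {set 'I_(n + n)}.
Local Notation S := {mpoly K[n + n]}.
Local Notation xi := (@lshift n n).
Local Notation yi := (@rshift n n).
Local Notation mon := 'X_{1..n + n}.

(** The exponents of the monomial map [x_i |-> s_(lab i) a_i], [y_i |-> a_i],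
    where [a_i] is the [i]-th variable of the first half and [s_l] the [l]-th of
    the second half: the toric parametrisation of a disjoint union of cliques,
    [lab i] being the clique of [i]. *)
Definition var_image (z : 'I_(n + n)) : mon :=
  match split z with
  | inl i => (U_(xi i) + U_(yi (lab i)))%MM
  | inr i => U_(xi i)%MM
  end.

Definition toric_tuple : (n + n).-tuple S :=
  [tuple if z \in Z then 0 else 'X_[var_image z] | z < n + n].
Local Notation toric_map := (comp_mpoly toric_tuple).

(** The image of a monomial records, for each vertex, its total exponent and,
    for each label, the total exponent of its [x] variables. *)
Definition mon_image (u : mon) : mon := (\sum_z var_image z *+ u z)%MM.

Definition avoids (u : mon) := [forall z in Z, u z == 0%N].

Lemma avoidsP u z : avoids u -> (0 < u z)%N -> z \notin Z.
Proof. by move=> /forall_inP uZ; apply: contraTN => /uZ /eqP->. Qed.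

Lemma toric_mapX u :
  toric_map 'X_[u] = if avoids u then 'X_[mon_image u] else 0.
Proof.
rewrite comp_mpolyX; case: ifP => [uZ|/negbT].
  rewrite -mprodXnE; apply: eq_bigr => z _; rewrite tnth_mktuple.
  have := @avoidsP u z uZ; case: (posnP (u z)) => [->|_ /(_ isT)/negPf->//].
  by rewrite !expr0.
rewrite negb_forall_in => /exists_inP[z Zz uz].
by rewrite (bigD1 z) //= tnth_mktuple Zz expr0n (negPf uz) mul0r.
Qed.

Lemma var_image_x i : var_image (xi i) = (U_(xi i) + U_(yi (lab i)))%MM.
Proof. by rewrite /var_image -[xi i]/(unsplit (inl i)) unsplitK. Qed.

Lemma var_image_y i : var_image (yi i) = U_(xi i)%MM.
Proof. by rewrite /var_image -[yi i]/(unsplit (inr i)) unsplitK. Qed.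

Lemma mon_imageD u v : mon_image (u + v) = (mon_image u + mon_image v)%MM.
Proof.
apply/mnmP => j; rewrite mnmDE !mnm_sumE -big_split; apply: eq_bigr => z _.
by rewrite /= !mulmnE mnmDE mulnDr.
Qed.

Lemma mon_imageU z : mon_image U_(z) = var_image z.
Proof.
apply/mnmP => j; rewrite mnm_sumE (bigD1 z) //= mulmnE mnm1E eqxx muln1.
by rewrite big1 ?addn0 // => y /negPf nyz; rewrite mulmnE mnm1E eq_sym nyz muln0.
Qed.

Lemma mon_image_vertex u i : mon_image u (xi i) = (u (xi i) + u (yi i))%N.
Proof.
rewrite mnm_sumE big_split_ord /= (bigD1 i) //= [in X in (_ + X)%N](bigD1 i) //=.
rewrite !mulmnE var_image_x var_image_y mnmDE !mnm1E eqxx eq_rlshift addn0 !mul1n.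
rewrite !big1 ?addn0 // => j /negPf ji; rewrite mulmnE ?var_image_y ?var_image_x.
  by rewrite mnm1E eq_lshift ji mul0n.
by rewrite mnmDE !mnm1E eq_lshift eq_rlshift ji mul0n.
Qed.

Lemma mon_image_label u l :
  mon_image u (yi l) = (\sum_(i | lab i == l) u (xi i))%N.
Proof.
rewrite mnm_sumE big_split_ord /= [X in (_ + X)%N]big1 ?addn0 => [|i _].
  rewrite [RHS]big_mkcond; apply: eq_bigr => i _.
  rewrite mulmnE var_image_x mnmDE !mnm1E eq_lrshift eq_rshift add0n.
  by case: eqP => _; rewrite ?mul1n ?mul0n.
by rewrite mulmnE var_image_y mnm1E eq_lrshift mul0n.
Qed.

(** The total [x]-exponent over a label is determined by the image, so a
    deficit at one vertex is made up for at another with the same label. *)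
Lemma label_exchange u v i : mon_image u = mon_image v ->
    (u (xi i) < v (xi i))%N ->
  exists2 j, lab j = lab i & (v (xi j) < u (xi j))%N.
Proof.
move=> uv lti; have /existsP[j /andP[/eqP lj ltj]] :
    [exists j, (lab j == lab i) && (v (xi j) < u (xi j))%N]; last by exists j.
apply: contraTT lti; rewrite negb_exists -leqNgt => /forallP le_uv.
have := mon_image_label u (lab i); rewrite uv mon_image_label.
rewrite (bigD1 i) //= [in RHS](bigD1 i) //=.
have le_sum : (\sum_(j | (lab j == lab i) && (j != i)) u (xi j) <=
   \sum_(j | (lab j == lab i) && (j != i)) v (xi j))%N.
  apply: leq_sum => j /andP[lj _].
  by have := le_uv j; rewrite lj /= -leqNgt.
move=> E; pose others j := (lab j == lab i) && (j != i).
by rewrite -(leq_add2r (\sum_(j | others j) v (xi j))) E leq_add2l.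
Qed.

Variable G : rel 'I_n.
Hypothesis lab_edge : forall i j, i != j -> lab i = lab j ->
  [&& xi i \notin Z, yi i \notin Z, xi j \notin Z & yi j \notin Z] -> G i j.

Local Notation I := (@edge_ideal K n G Z).
Let subI := @edge_ideal_submod K n G Z.

(** Two monomials with the same image are related by exchanges
    [x_i y_j -> x_j y_i] within a clique; each exchange reduces the excess of
    the [x]-exponents of [u] over those of [v]. *)
Lemma toric_congruence u v : avoids u -> avoids v ->
  mon_image u = mon_image v -> I ('X_[u] - 'X_[v]).
Proof.
move=> uZ vZ; have [k] := ubnP (\sum_i (u (xi i) - v (xi i)))%N.
elim: k u uZ => // k IH u uZ /ltnSE lek uv.
have vtx i : (u (xi i) + u (yi i) = v (xi i) + v (yi i))%N.
  by rewrite -!mon_image_vertex uv.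
have [/existsP[i lti]|] := boolP [exists i, (v (xi i) < u (xi i))%N]; last first.
  rewrite negb_exists => /forallP le_uv.
  have eqx i : u (xi i) = v (xi i).
    have := le_uv i; rewrite -leqNgt leq_eqVlt => /predU1P[//|lt_i].
    by have [j _] := label_exchange uv lt_i; rewrite (negPf (le_uv j)).
  suff -> : u = v by rewrite subrr; apply: submod0 subI.
  apply/mnmP => z; rewrite -(splitK z); case: (split z) => i /=; first exact: eqx.
  by have := vtx i; rewrite eqx => /addnI.
have [j lab_ji ltj] := label_exchange (esym uv) lti.
have ne_ij : i != j by apply: contraTneq lti => ->; rewrite -leqNgt ltnW.
have xiZ : xi i \notin Z by apply: avoidsP uZ _; lia.
have yjZ : yi j \notin Z by apply: avoidsP uZ _; have := vtx j; lia.
have xjZ : xi j \notin Z by apply: avoidsP vZ _; lia.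
have yiZ : yi i \notin Z by apply: avoidsP vZ _; have := vtx i; lia.
pose w : mon := (u - (U_(xi i) + U_(yi j)))%MM.
have uE : u = (w + (U_(xi i) + U_(yi j)))%MM.
  rewrite submK //; apply/mnm_lepP => z; rewrite mnmDE !mnm1E.
  have [<-|_] := eqVneq (xi i) z; first by rewrite eq_rlshift; lia.
  have [<-|_] := eqVneq (yi j) z; last by [].
  by have := vtx j; lia.
pose u' : mon := (w + (U_(xi j) + U_(yi i)))%MM.
have -> : 'X_[u] - 'X_[v] = ('X_[w] * edge_binomial K i j) + ('X_[u'] - 'X_[v]) :> S.
  by rewrite {1}uE /u' !mpolyXD /edge_binomial /xvar /yvar; ring.
apply: (submodD subI).
  apply: (submodZ subI 'X_[w]); apply: span_gen; constructor; apply: lab_edge => //.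
  by rewrite xiZ yiZ xjZ.
have wZ z : z \in Z -> w z = 0%N.
  by move=> Zz; rewrite mnmBE; move/forall_inP: uZ => /(_ z Zz)/eqP->.
apply: IH.
- apply/forall_inP => z Zz; rewrite !mnmDE wZ // !mnm1E.
  have [xjz|_] := eqVneq (xi j) z; first by rewrite xjz Zz in xjZ.
  by have [yiz|//] := eqVneq (yi i) z; rewrite yiz Zz in yiZ.
- apply: leq_trans lek; rewrite (bigD1 i) //= [in X in (_ < X)%N](bigD1 i) //=.
  have u'i : (u' (xi i)).+1 = u (xi i).
    rewrite uE /u' !mnmDE !mnm1E !eq_rlshift !eq_lshift eqxx [j == i]eq_sym.
    by rewrite (negPf ne_ij) /=; lia.
  rewrite -addSn leq_add //; first by lia.
  apply: leq_sum => l li.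
  have -> : u' (xi l) = (u (xi l) + (j == l))%N.
    rewrite uE /u' !mnmDE !mnm1E !eq_rlshift !eq_lshift.
    by rewrite [i == l]eq_sym (negPf li) /=; lia.
  by case: eqP => [<-|_]; lia.
- rewrite -uv uE /u' !mon_imageD !mon_imageU !var_image_x !var_image_y lab_ji.
  by apply/mnmP => z; rewrite !mnmDE; lia.
Qed.

(** Induction on the number of terms: in a polynomial of the kernel every
    surviving monomial has a companion with the same image, and their difference
    lies in the ideal. *)
Lemma toric_kernel f : toric_map f = 0 -> I f.
Proof.
have [k] := ubnP (size (msupp f)); elim: k f => // k IH f /ltnSE le_k f0.
have [f_0|/eqP] := eqVneq (msupp f) [::].
  by rewrite (msuppnil0 f_0); apply: submod0 subI.
case def_s: (msupp f) => [//|u s] _.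
have uf : u \in msupp f by rewrite def_s mem_head.
(* It is enough to subtract some [g] of the ideal that removes the term [u]
   without creating a new one. *)
have shrink g : I g -> toric_map g = 0 -> g@_u = f@_u ->
    {subset msupp g <= msupp f} -> I f.
  move=> Ig g0 gu sgf; rewrite -(subrK g f); apply: (submodD subI) Ig.
  apply: IH; last by rewrite raddfB /= f0 g0 subrr.
  apply: leq_trans le_k; rewrite ltnNge; apply/negP => le_sz.
  have sub : {subset msupp (f - g) <= msupp f}.
    by move=> w /msuppB_le; rewrite mem_cat => /orP[//|/sgf].
  have [_ /(_ u)] := uniq_min_size (msupp_uniq (f - g)) sub le_sz.
  by rewrite uf mcoeff_msupp mcoeffB gu subrr eqxx.
have [uZ|uZ] := boolP (avoids u); last first.
  apply: (shrink (f@_u *: 'X_[u])).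
  - rewrite -mul_mpolyC; apply: (submodZ subI (f@_u)%:MP).
    move: uZ; rewrite negb_forall_in => /exists_inP[z Zz uz].
    have leU : (U_(z) <= u)%MM by rewrite lep1mP.
    rewrite -(submK leU) mpolyXD; apply: (submodZ subI 'X_[u - U_(z)]).
    by apply: span_gen; constructor.
  - by rewrite linearZ /= toric_mapX (negPf uZ) scaler0.
  - by rewrite mcoeffZ mcoeffX eqxx mulr1.
  - by move=> w /msuppZ_le; rewrite msuppX inE => /eqP->.
have [v [vf vu vZ uv]] : exists v,
    [/\ v \in msupp f, v != u, avoids v & mon_image u = mon_image v].
  have [/hasP[v vf /and3P[? ? /eqP ?]]|no_v] :=
    boolP (has (fun v => [&& v != u, avoids v & mon_image u == mon_image v]) (msupp f)).
    by exists v.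
  have := congr1 (mcoeff (mon_image u)) f0.
  rewrite mcoeff0 [f in comp_mpoly _ f]mpolyE (raddf_sum toric_map).
  rewrite (raddf_sum (mcoeff _)) /=.
  rewrite (bigD1_seq u) ?msupp_uniq //= linearZ /= toric_mapX uZ mcoeffZ mcoeffX.
  rewrite eqxx mulr1 big_seq_cond big1 => [|v /andP[vf vu]].
    by rewrite addr0 => /eqP; rewrite mcoeff_eq0 uf.
  rewrite linearZ /= toric_mapX mcoeffZ; case: ifP => vZ; last by rewrite mcoeff0 mulr0.
  move/hasPn: no_v => /(_ v vf); rewrite vu vZ /= mcoeffX eq_sym => /negPf->.
  by rewrite mulr0.
apply: (shrink (f@_u *: ('X_[u] - 'X_[v]))).
- by rewrite -mul_mpolyC; apply: (submodZ subI (f@_u)%:MP); apply: toric_congruence.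
- by rewrite linearZ raddfB /= !toric_mapX uZ vZ uv subrr scaler0.
- by rewrite mcoeffZ mcoeffB !mcoeffX eqxx (negPf vu) subr0 mulr1.
- move=> w /msuppZ_le /msuppB_le; rewrite mem_cat !msuppX !inE.
  by case/orP => /eqP->.
Qed.

Hypothesis edge_lab : forall i j, G i j -> toric_map (edge_binomial K i j) = 0.

(** The ideal is the kernel of a map to a domain that does not kill ['X_z]. *)
Lemma toric_nzd z f : z \notin Z -> I ('X_z * f) -> I f.
Proof.
move=> zZ Izf; apply: toric_kernel.
have /eqP : toric_map ('X_z * f) = 0.
  elim: Izf => [|a g h gens _ IH]; first by rewrite raddf0.
  rewrite raddfD /= rmorphM /= IH addr0.
  case: gens => [y Zy|i j /edge_lab->]; last by rewrite mulr0.
  by rewrite comp_mpolyXU -tnth_nth tnth_mktuple Zy mulr0.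
rewrite rmorphM mulf_eq0 /= comp_mpolyXU -tnth_nth tnth_mktuple (negPf zZ).
by rewrite (negPf (mpolyX_neq0 K _)) => /eqP.
Qed.

End Toric.

(** * Merging cliques and removing vertices *)

Section Blocks.
Variables (K : fieldType) (n : nat).
Local Notation S := {mpoly K[n + n]}.
Local Notation xi := (@lshift n n).
Local Notation yi := (@rshift n n).
Local Notation xv := (@xvar K n).
Local Notation yv := (@yvar K n).
Local Notation I := (@edge_ideal K n).
Implicit Types (Bs : seq {set 'I_n}) (C D : {set 'I_n}).

Definition vertex (z : 'I_(n + n)) : 'I_n :=
  match split z with inl i => i | inr i => i end.

Lemma vertex_x i : vertex (xi i) = i.
Proof. by rewrite /vertex -[xi i]/(unsplit (inl i)) unsplitK. Qed.

Lemma vertex_y i : vertex (yi i) = i.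
Proof. by rewrite /vertex -[yi i]/(unsplit (inr i)) unsplitK. Qed.

Lemma vertexP z : z = xi (vertex z) \/ z = yi (vertex z).
Proof.
by rewrite -(splitK z); case: (split z) => i /=; rewrite ?vertex_x ?vertex_y; [left|right].
Qed.

Definition vars D : {set 'I_(n + n)} := [set z | vertex z \in D].

(** The graph whose edges are the pairs covered by some block. *)
Definition block_rel Bs : rel 'I_n :=
  [rel i j | (i != j) && has (fun C : {set 'I_n} => (i \in C) && (j \in C)) Bs].

Lemma block_relP Bs i j :
  reflect (i != j /\ exists C, [/\ C \in Bs, i \in C & j \in C]) (block_rel Bs i j).
Proof.
apply: (iffP andP) => [[ne /hasP[C BC /andP[iC jC]]]|[ne [C [BC iC jC]]]].
  by split=> //; exists C.
by split=> //; apply/hasP; exists C; rewrite ?iC.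
Qed.

Lemma edge_swap (i j : 'I_n) : edge_binomial K j i = - edge_binomial K i j.
Proof. by rewrite /edge_binomial opprB. Qed.

Section MergeBlocks.
Variables (Bs : seq {set 'I_n}) (i : 'I_n).

(** Merging the blocks through [i] amounts to completing the neighbourhood of
    [i] to a clique. *)
Definition merge_blocks : seq {set 'I_n} :=
  (\bigcup_(C in [seq C : {set 'I_n} <- Bs | i \in C]) C) ::
  [seq C : {set 'I_n} <- Bs | i \notin C].

Lemma size_merge_blocks :
  size merge_blocks = (size Bs - count (fun C : {set 'I_n} => i \in C) Bs).+1.
Proof.
rewrite /= size_filter -(count_predC (fun C : {set 'I_n} => i \in C) Bs).
by rewrite addKn.
Qed.

Lemma sub_merge_blocks j k : block_rel Bs j k -> block_rel merge_blocks j k.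
Proof.
case/block_relP=> ne [C [BC jC kC]]; apply/block_relP; split=> //.
have [iC|iC] := boolP (i \in C).
  exists (\bigcup_(C in [seq C : {set 'I_n} <- Bs | i \in C]) C); rewrite mem_head.
  by split=> //; apply/bigcupP; exists C => //; rewrite mem_filter iC.
by exists C; rewrite inE mem_filter iC BC orbT.
Qed.

Lemma merge_blocksP j k : block_rel merge_blocks j k ->
  block_rel Bs j k \/
  [/\ j != k, (j == i) || block_rel Bs i j & (k == i) || block_rel Bs i k].
Proof.
case/block_relP=> ne [C [BC jC kC]].
have [C_eq|] := eqVneq C (\bigcup_(C in [seq C : {set 'I_n} <- Bs | i \in C]) C).
  have link l : l \in C -> (l == i) || block_rel Bs i l.
    rewrite C_eq => /bigcupP[B]; rewrite mem_filter => /andP[iB BB] lB.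
    case: eqVneq => //= nli; apply/block_relP; rewrite eq_sym; split=> //.
    by exists B.
  by right; split; rewrite ?link.
move=> neC; left; apply/block_relP; split=> //; exists C; split=> //.
by move: BC; rewrite inE (negPf neC) /= mem_filter => /andP[].
Qed.

(** The three-term relation [x_i f_jk = x_j f_ik - x_k f_ij], and its analogue
    for [y_i]. *)
Lemma edge_cone (J : S -> Prop) j k : submod_pred (J : S^o -> Prop) ->
    J (edge_binomial K i j) -> J (edge_binomial K i k) ->
  J (xv i * edge_binomial K j k) /\ J (yv i * edge_binomial K j k).
Proof.
move=> subJ Jj Jk.
have ->: xv i * edge_binomial K j k =
   xv j * edge_binomial K i k - xv k * edge_binomial K i j.
  by rewrite /edge_binomial; ring.
have ->: yv i * edge_binomial K j k =
   yv j * edge_binomial K i k - yv k * edge_binomial K i j.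
  by rewrite /edge_binomial; ring.
by split; apply: (submodB subJ); apply: (submodZ subJ).
Qed.

(** Ohtani's decomposition at [i]: both variables of [i] carry every edge added
    by the merge into the ideal, and no added edge involves [i]. *)
Lemma reg_merge_blocks D r :
    koszul_reg_le (I (block_rel merge_blocks) (vars D)) r.+1 ->
    koszul_reg_le (I (block_rel Bs) (vars (i |: D))) r.+1 ->
    koszul_reg_le (I (block_rel merge_blocks) (vars (i |: D))) r ->
  koszul_reg_le (I (block_rel Bs) (vars D)) r.+1.
Proof.
have -> : vars (i |: D) = vars [set i] :|: vars D by apply/setP => z; rewrite !inE.
set Z := vars D; have subI := @edge_ideal_submod K n (block_rel Bs) Z.
set J := edge_ideal (block_rel Bs) Z in subI *.
have killx (Y : {set 'I_(n + n)}) j :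
    comp_mpoly (kill_tuple K (mem Y)) (xv j) = if xi j \in Y then 0 else xv j.
  exact: killX.
have killy (Y : {set 'I_(n + n)}) j :
    comp_mpoly (kill_tuple K (mem Y)) (yv j) = if yi j \in Y then 0 else yv j.
  exact: killX.
have kill_edge j k : comp_mpoly (kill_tuple K (mem (vars [set i]))) (edge_binomial K j k) =
    if (j == i) || (k == i) then 0 else edge_binomial K j k.
  rewrite /edge_binomial raddfB /= !rmorphM /= !killx !killy !inE !vertex_x !vertex_y.
  by case: eqP; case: eqP => _ _ /=; rewrite ?(mul0r, mulr0, subrr).
have J0 : J 0 := span_zero _.
have JX z : z \in Z -> J 'X_z by move=> Zz; apply: span_gen; constructor.
have Jedge j k : block_rel Bs j k -> J (edge_binomial K j k).
  by move=> jk; apply: span_gen; constructor.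
apply: reg_edge_ideal_cap => //; first exact: sub_merge_blocks.
- move=> g [z /JX Jz|j k /Jedge Jjk].
    by rewrite killX; case: ifP.
  by rewrite kill_edge; case: ifP.
- move=> g [z /JX Jz|j k /merge_blocksP jk].
    by rewrite killX; case: ifP => _; rewrite ?subr0 ?subrr.
  rewrite kill_edge; case: ifP => [jki|_]; last by rewrite subrr.
  rewrite subr0; case: jk => [/Jedge//|[ne ij ik]].
  case/orP: jki => /eqP ei; subst.
    by rewrite eq_sym (negPf ne) in ik; apply: Jedge.
  rewrite (negPf ne) /= in ij.
  by rewrite edge_swap; apply: (submodN subI); apply: Jedge.
- move=> g z [y /JX Jy|j k /merge_blocksP jk] iz; first exact: (submodZ subI).
  case: jk => [/Jedge|[ne ij ik]]; first exact: (submodZ subI).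
  have cone : J (xv i * edge_binomial K j k) /\ J (yv i * edge_binomial K j k).
    apply: edge_cone => //.
      case: eqVneq ij => [-> _|_ /Jedge//].
      by rewrite /edge_binomial subrr.
    case: eqVneq ik => [-> _|_ /Jedge//].
    by rewrite /edge_binomial subrr.
  move: iz; rewrite !inE => /eqP zi; case: cone; rewrite /xvar /yvar -zi.
  by case: (vertexP z) => <-.
Qed.

End MergeBlocks.

(** Variables may be added one at a time as long as each is a nonzerodivisor. *)
Lemma reg_edge_ideal_subset (G : rel 'I_n) (Z0 Z1 : {set 'I_(n + n)}) r :
    Z0 \subset Z1 ->
    (forall (Z : {set 'I_(n + n)}) z f, Z0 \subset Z -> Z \subset Z1 ->
      z \in Z1 -> z \notin Z -> I G Z ('X_z * f) -> I G Z f) ->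
  koszul_reg_le (I G Z1) r -> koszul_reg_le (I G Z0) r.
Proof.
move=> s01 nzd reg1; have [k] := ubnP #|Z1 :\: Z0|.
elim: k Z0 s01 nzd => // k IH Z0 s01 nzd /ltnSE lek.
have [/eqP|[z]] := set_0Vmem (Z1 :\: Z0).
  rewrite setD_eq0 => s10.
  by have -> : Z0 = Z1 by apply/eqP; rewrite eqEsubset s01.
rewrite inE => /andP[zZ0 zZ1]; apply: (@reg_edge_ideal_add_var _ _ _ _ z).
  by move=> f; apply: nzd.
apply: IH => [|Z y f sZ|].
- by rewrite subUset sub1set zZ1.
- by apply: nzd; apply: subset_trans sZ; apply: subsetUr.
- apply: leq_trans lek; apply: proper_card; apply/properP; split.
    by apply: setDS; apply: subsetUr.
  by exists z; rewrite !inE ?eqxx // zZ0.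
Qed.

Section DisjointBlocks.
Variables (Bs : seq {set 'I_n}) (D : {set 'I_n}).
Hypothesis disj : forall j, j \notin D ->
  (count (fun C : {set 'I_n} => j \in C) Bs <= 1)%N.

Lemma disjoint_blocks j B C : j \notin D -> B \in Bs -> C \in Bs ->
  j \in B -> j \in C -> B = C.
Proof.
move=> /disj; rewrite -size_filter => le1 BB CC jB jC.
have : B \in [seq C : {set 'I_n} <- Bs | j \in C] by rewrite mem_filter jB.
have : C \in [seq C : {set 'I_n} <- Bs | j \in C] by rewrite mem_filter jC.
by case: filter le1 => [//|E [|//]] _; rewrite !inE => /eqP-> /eqP->.
Qed.

Definition same_block : rel 'I_n :=
  [rel j k | (j == k) || [&& j \notin D, k \notin D & block_rel Bs j k]].

(** A canonical representative of the block of [j], for disjoint blocks. *)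
Definition block_label (j : 'I_n) : 'I_n := odflt j [pick k | same_block j k].

Lemma same_block_sym j k : same_block j k = same_block k j.
Proof.
rewrite /same_block /= eq_sym andbCA; congr (_ || [&& _, _ & (_ && _)]).
  by rewrite eq_sym.
by apply: eq_has => C; rewrite andbC.
Qed.

Lemma same_block_trans : transitive same_block.
Proof.
move=> k j l /predU1P[-> //|/and3P[jD kD /block_relP[_ [B [BB jB kB]]]]].
case/predU1P=> [<-|/and3P[_ lD /block_relP[_ [C [CC kC lC]]]]].
  rewrite /same_block /=; case: eqVneq => //= jk; rewrite jD kD.
  by apply/block_relP; split=> //; exists B.
rewrite /same_block /=; case: eqVneq => //= jl; rewrite jD lD.
apply/block_relP; split=> //; exists B; split=> //.
by rewrite (disjoint_blocks kD BB CC kB kC).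
Qed.

Lemma block_labelP j k : reflect (block_label j = block_label k) (same_block j k).
Proof.
have lab l : same_block l (block_label l).
  by rewrite /block_label; case: pickP => [//|/(_ l)]; rewrite /same_block /= eqxx.
apply: (iffP idP) => [jk|jk]; last first.
  apply: same_block_trans (lab j) _; rewrite jk same_block_sym; exact: lab.
rewrite /block_label.
have -> : [pick l | same_block j l] = [pick l | same_block k l].
  apply: eq_pick => l; apply/idP/idP; apply: same_block_trans => //.
  by rewrite same_block_sym.
by case: pickP => // /(_ k); rewrite /same_block /= eqxx.
Qed.

(** The hypothesis on edges says that the graph on the live vertices is still a
    disjoint union of cliques after killing [Z]: an edge is either untouched, or
    loses both its [x] variables, in which case its binomial vanishes. *)
Lemma blocks_nzd (Z : {set 'I_(n + n)}) z f : vars D \subset Z ->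
    (forall j k, j \notin D -> k \notin D -> block_rel Bs j k ->
      [&& xi j \notin Z, yi j \notin Z, xi k \notin Z & yi k \notin Z] \/
      (xi j \in Z /\ xi k \in Z)) ->
  z \notin Z -> I (block_rel Bs) Z ('X_z * f) -> I (block_rel Bs) Z f.
Proof.
move=> /subsetP sDZ dead; apply: (toric_nzd (lab := block_label)).
  move=> i j ne /block_labelP; rewrite /same_block /= (negPf ne) /=.
  by case/and3P.
move=> j k jk.
have tx l : comp_mpoly (toric_tuple K block_label Z) (xv l) =
   if xi l \in Z then 0 else 'X_[U_(xi l)] * 'X_[U_(yi (block_label l))].
  by rewrite comp_mpolyXU -tnth_nth tnth_mktuple var_image_x mpolyXD.
have ty l : comp_mpoly (toric_tuple K block_label Z) (yv l) =
   if yi l \in Z then 0 else 'X_[U_(xi l)].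
  by rewrite comp_mpolyXU -tnth_nth tnth_mktuple var_image_y.
rewrite raddfB /= !rmorphM /= !tx !ty.
have inZ l : l \in D -> (xi l \in Z) /\ (yi l \in Z).
  by move=> lD; split; apply: sDZ; rewrite inE ?vertex_x ?vertex_y.
have [/inZ[-> ->]|jD] := boolP (j \in D); first by rewrite !(mul0r, mulr0) subrr.
have [/inZ[-> ->]|kD] := boolP (k \in D); first by rewrite !(mul0r, mulr0) subrr.
case: (dead j k jD kD jk) => [|[-> ->]]; last by rewrite !mul0r subrr.
case/and4P=> /negPf-> /negPf-> /negPf-> /negPf->.
have -> : block_label j = block_label k.
  by apply/block_labelP; rewrite /same_block /= jD kD jk orbT.
by ring.
Qed.

Lemma reg_isolated i r : i \notin D ->
    (forall C, C \in Bs -> i \notin C) ->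
  koszul_reg_le (I (block_rel Bs) (vars (i |: D))) r ->
  koszul_reg_le (I (block_rel Bs) (vars D)) r.
Proof.
move=> iD iBs; apply: reg_edge_ideal_subset.
  by apply/subsetP => z; rewrite !inE => ->; rewrite orbT.
move=> Z z f sDZ /subsetP sZ _ zZ; apply: blocks_nzd zZ => // j k jD kD.
case/block_relP=> _ [C [BC jC kC]]; left.
have live l : l \in C -> l \notin D -> (xi l \notin Z) && (yi l \notin Z).
  move=> lC lD; have ne_li : l != i by apply: contraTneq lC => ->; apply: iBs.
  by apply/andP; split; apply: contraNN lD => /sZ;
    rewrite !inE ?vertex_x ?vertex_y (negPf ne_li).
by rewrite andbA !live.
Qed.

(** Modulo the nonzerodivisor [x_i], the product [x_j y_i] of each neighbour [j]
    lies in the ideal; hence the ideal is the intersection of the one that kills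
    the [x_j] for [j] in [C] and of the one that kills [y_i].  In the first
    ideal, and in the sum, the remaining [y_j], [j] in [C], are free
    variables, and killing them leaves the graph without [C]. *)
Lemma reg_remove_clique_vertex C i r : i \notin D -> C \in Bs -> i \in C ->
    koszul_reg_le (I (block_rel Bs) (vars (i |: D))) r.+1 ->
    koszul_reg_le (I (block_rel Bs) (vars (C :|: D))) r ->
  koszul_reg_le (I (block_rel Bs) (vars D)) r.+1.
Proof.
move=> iD BC iC reg_i reg_C; set G := block_rel Bs.
apply: (@reg_edge_ideal_add_var _ _ _ _ (xi i)).
  move=> f; apply: blocks_nzd => // [j k jD kD _|]; last by rewrite inE vertex_x.
  by left; rewrite !inE !vertex_x !vertex_y jD kD.
pose xC : {set 'I_(n + n)} := [set xi j | j in C].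
have iCx : xi i \in xC by apply: imset_f.
pose Z1 := xC :|: vars D.
have regZ1 (Z : {set 'I_(n + n)}) : Z1 \subset Z ->
    Z \subset vars (C :|: D) -> koszul_reg_le (I G Z) r.
  move=> sZ1 sZ2; apply: reg_edge_ideal_subset reg_C => // Z' z f sZ' /subsetP sZ'2 _ zZ'.
  have /subsetP sZ1' := subset_trans sZ1 sZ'.
  apply: blocks_nzd zZ' => //.
    by apply/subsetP => y yD; apply: sZ1'; rewrite inE yD orbT.
  move=> j k jD kD /block_relP[_ [B [BB jB kB]]].
  have [B_C|ne_BC] := eqVneq B C.
    by right; split; apply: sZ1'; rewrite inE imset_f // -B_C.
  have live l : l \notin D -> l \in B -> (xi l \notin Z') && (yi l \notin Z').
    move=> lD lB; have lC : l \notin C.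
      by apply: contra ne_BC => lC; apply/eqP; apply: disjoint_blocks lD BB BC lB lC.
    by apply/andP; split; apply/negP => /sZ'2;
      rewrite !inE ?vertex_x ?vertex_y (negPf lD) (negPf lC).
  by left; rewrite andbA !live.
have subZ1 : Z1 \subset vars (C :|: D).
  apply/subsetP => z; rewrite !inE => /orP[/imsetP[j jC ->]|->].
    by rewrite vertex_x jC.
  by rewrite orbT.
set Z := xi i |: vars D; have subI := @edge_ideal_submod K n G Z.
set J := edge_ideal G Z in subI *.
have JX z : z \in Z -> J 'X_z by move=> Zz; apply: span_gen; constructor.
have Jedge j k : G j k -> J (edge_binomial K j k).
  by move=> jk; apply: span_gen; constructor.
have killX' z :
    comp_mpoly (kill_tuple K (mem [set yi i])) 'X_z = if z == yi i then 0 else 'X_z.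
  by rewrite killX -[mem _ z]/(z \in [set yi i]) inE.
have kill_edge j k : G j k ->
    J (comp_mpoly (kill_tuple K (mem [set yi i])) (edge_binomial K j k)).
  move=> jk; rewrite /edge_binomial raddfB /= !rmorphM /= /xvar /yvar !killX'.
  rewrite !eq_lrshift !eq_rshift.
  have Jx : J 'X_(xi i) by apply: JX; rewrite !inE eqxx.
  have [k_i|_] := eqVneq k i; have [j_i|_] := eqVneq j i.
  + by rewrite !mulr0 subrr; apply: (submod0 subI).
  + rewrite k_i mulr0 sub0r mulrC; apply: (submodN subI).
    exact: (submodZ subI).
  + by rewrite j_i mulr0 subr0 mulrC; apply: (submodZ subI).
  + exact: Jedge.
apply: (@reg_edge_ideal_cap _ _ G G Z Z1 [set yi i]) => //.
- by apply/subsetP => z; rewrite !inE => /predU1P[->|->]; rewrite ?iCx ?orbT.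
- move=> g [z /JX Jz|j k jk].
    by rewrite killX'; case: ifP => _ //; apply: (submod0 subI).
  exact: kill_edge.
- move=> g [z Zz|j k jk]; last first.
    by apply: (submodB subI) (kill_edge _ _ jk); apply: Jedge.
  rewrite killX'; case: eqP => [z_y|_]; last by rewrite subrr; apply: (submod0 subI).
  rewrite subr0; apply: JX; move: Zz; rewrite !inE z_y => /orP[/imsetP[j _ /eqP]|->].
    by rewrite eq_rlshift.
  by rewrite orbT.
- move=> g z gens; rewrite inE => /eqP->; case: gens => [w|j k jk]; last first.
    by apply: (submodZ subI); apply: Jedge.
  rewrite inE => /orP[/imsetP[j jC ->]|Dw]; last first.
    by apply: (submodZ subI); apply: JX; rewrite inE Dw orbT.
  have [->|ne_ji] := eqVneq j i.
    by apply: (submodZ subI); apply: JX; rewrite !inE eqxx.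
  (* The edge binomial of [i] and [j], modulo [x_i]. *)
  have -> : 'X_(yi i) * 'X_(xi j) =
      'X_(yi j) * 'X_(xi i) - edge_binomial K i j :> S.
    by rewrite /edge_binomial /xvar /yvar; ring.
  apply: (submodB subI).
    by apply: (submodZ subI); apply: JX; rewrite !inE eqxx.
  by apply: Jedge; apply/block_relP; rewrite eq_sym; split=> //; exists C.
- by apply: koszul_reg_leW (leqnSn r) _; apply: regZ1.
- have -> : [set yi i] :|: Z = vars (i |: D); last exact: reg_i.
  apply/setP => z; rewrite !inE orbA; congr (_ || _).
  apply/orP/eqP => [[]/eqP->|zi]; rewrite ?vertex_x ?vertex_y //.
  by case: (vertexP z) => ->; rewrite zi eqxx; [right|left].
- apply: regZ1; first exact: subsetUr.
  by rewrite subUset subZ1 andbT sub1set !inE vertex_y iC.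
Qed.

End DisjointBlocks.
End Blocks.

(** * The bound by the number of cliques in a cover *)

Section Bound.
Variables (K : fieldType) (n : nat).
Local Notation I := (@edge_ideal K n).
Implicit Types (Bs : seq {set 'I_n}) (C D : {set 'I_n}).

Lemma edge_ideal_rem_block Bs C D f : C \in Bs ->
  I (block_rel (rem C Bs)) (vars (C :|: D)) f <->
  I (block_rel Bs) (vars (C :|: D)) f.
Proof.
move=> BC; have subI := edge_ideal_submod K (block_rel (rem C Bs)) (vars (C :|: D)).
split; first apply: edge_idealS => // j k /block_relP[ne [B [BB jB kB]]].
  by apply/block_relP; split=> //; exists B; rewrite (mem_rem BB).
apply: span_sub => // g [z Zz|j k /block_relP[ne [B [BB jB kB]]]].
  by apply: span_gen; constructor.
have [B_C|ne_BC] := eqVneq B C; last first.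
  apply: span_gen; constructor; apply/block_relP; split=> //; exists B; split=> //.
  by move: BB; rewrite (perm_mem (perm_to_rem BC)) inE (negPf ne_BC).
have inI l : l \in B ->
    I (block_rel (rem C Bs)) (vars (C :|: D)) (xvar K l).
  by move=> lB; apply: span_gen; constructor; rewrite !inE vertex_x -B_C lB.
rewrite /edge_binomial mulrC [X in _ - X]mulrC.
by apply: (submodB subI); apply: (submodZ subI); apply: inI.
Qed.

(** Outer induction on the number of live vertices, inner induction on the
    number of blocks: merging blocks keeps the vertices but lowers the number of
    blocks, all other steps make a vertex dead. *)
Theorem reg_clique_cover Bs D :
  koszul_reg_le (I (block_rel Bs) (vars D)) (size Bs).
Proof.
suff bound k r : forall Bs D, (#|~: D| < k)%N -> (size Bs <= r)%N ->
    koszul_reg_le (I (block_rel Bs) (vars D)) r.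
  exact: (bound #|~: D|.+1).
elim: k r => [//|k IHk] r; elim/ltn_ind: r => r IHr {}Bs {}D leD leBs.
have [D_T|[i]] := set_0Vmem (~: D).
  have -> : vars D = setT.
    by rewrite -[D]setCK D_T setC0; apply/setP => z; rewrite !inE.
  by apply: koszul_reg_leW (leq0n r) _; apply: reg_edge_ideal_top.
rewrite inE => iD.
have shrink (E : {set 'I_n}) j : j \notin D -> j \in E -> (#|~: (E :|: D)| < k)%N.
  move=> jD jE; apply: leq_trans (ltnSE leD); apply: proper_card.
  apply/properP; split; first by rewrite setCS subsetUr.
  by exists j; rewrite !inE ?jD ?jE.
have [disj|] := boolP [forall j, (j \notin D) ==>
   (count (fun C : {set 'I_n} => j \in C) Bs <= 1)%N].
  have {}disj j : j \notin D ->
      (count (fun C : {set 'I_n} => j \in C) Bs <= 1)%N.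
    by move/forallP: disj => /(_ j)/implyP.
  have [/hasP[C BC iC]|/hasPn iBs] :=
    boolP (has (fun C : {set 'I_n} => i \in C) Bs).
    case: r leBs {IHr} => [|r] leBs; first by case: (Bs) BC leBs.
    apply: (reg_remove_clique_vertex disj iD BC iC).
      by apply: IHk => //; apply: shrink iD _; rewrite inE.
    apply: (koszul_reg_eq (fun f => edge_ideal_rem_block D f BC)).
    apply: IHk; first exact: shrink iC.
    by rewrite size_rem //; case: (Bs) BC leBs.
  apply: (reg_isolated disj iD iBs); apply: IHk => //.
  by apply: shrink iD _; rewrite inE.
rewrite negb_forall => /existsP[j]; rewrite negb_imply -ltnNge.
move=> /andP[jD j2].
have ltDj : (#|~: (j |: D)| < k)%N by apply: shrink jD _; rewrite inE.
case: r leBs IHr => [|r] leBs IHr.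
  by move: leBs j2; rewrite leqn0 => /nilP->.
have leM : (size (merge_blocks Bs j) <= r)%N.
  rewrite size_merge_blocks; move: j2 leBs.
  have := count_size (fun C : {set 'I_n} => j \in C) Bs.
  by move: (count _ _) (size Bs) => c s; lia.
apply: (@reg_merge_blocks _ _ _ j); try exact: IHk.
by apply: koszul_reg_leW (leqnSn r) _; apply: IHr.
Qed.

Lemma binomial_edge_idealE (G : rel 'I_n) Bs f : ssrbool.symmetric G ->
    (forall i j, G i j = block_rel Bs i j) ->
  I (block_rel Bs) (vars set0) f <-> binomial_edge_ideal G f.
Proof.
move=> symG GB; split=> [|[c ->]]; last first.
  have subI := edge_ideal_submod K (block_rel Bs) (vars set0).
  apply: (big_ind (I (block_rel Bs) (vars set0))); first exact: (submod0 subI).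
    exact: (submodD subI).
  move=> [i j] /= /andP[_ Gij]; apply: (submodZ subI).
  by apply: span_gen; apply: gen_edge; rewrite -GB.
apply: span_sub.
  split=> [|u v [c ->] [d ->]|a u [c ->]].
  - by exists (fun=> 0); rewrite big1 // => e _; rewrite mul0r.
  - exists (fun e => c e + d e); rewrite -big_split; apply: eq_bigr => e _.
    by rewrite mulrDl.
  - exists (fun e => a * c e); rewrite /GRing.scale /= mulr_sumr.
    by apply: eq_bigr => e _; rewrite mulrA.
move=> g [z|i j]; first by rewrite !inE.
wlog lt_ij : i j / (i < j)%N.
  move=> wlt Bij; have [lt|lt|/val_inj ij] := ltngtP i j; first exact: wlt.
    have [|c cE] := wlt j i lt; first by rewrite -GB symG GB.
    exists (fun e => - c e); rewrite edge_swap cE -sumrN.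
    by apply: eq_bigr => e _; rewrite mulNr.
  by case/block_relP: Bij; rewrite ij eqxx.
rewrite -GB => Gij; exists (fun e => (e == (i, j))%:R).
rewrite (bigD1 (i, j)) /=; last by rewrite lt_ij.
by rewrite eqxx mul1r big1 ?addr0 // => e /andP[_ /negPf->]; rewrite mul0r.
Qed.

End Bound.

Lemma maximal_cliques_cover n (G : rel 'I_n) i j :
    ssrbool.symmetric G -> irreflexive G ->
  G i j = block_rel (enum (maximal_cliques G)) i j.
Proof.
move=> symG irrG; apply/idP/block_relP => [Gij|[ne [A []]]]; last first.
  rewrite mem_enum inE => /maxsetp /forall_inP cA iA jA.
  by have /forall_inP/(_ j jA)/implyP := cA i iA; apply.
split; first by apply: contraTneq Gij => ->; rewrite irrG.
have [|A mA] := @maxset_exists _ (is_clique G) [set i; j].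
  apply/forall_inP => k; rewrite !inE => ki; apply/forall_inP => l; rewrite !inE => lj.
  by apply/implyP; case/orP: ki => /eqP->; case/orP: lj => /eqP->; rewrite ?eqxx // symG.
move=> /subsetP sA; exists A; rewrite mem_enum inE mA.
by split=> //; apply: sA; rewrite !inE eqxx ?orbT.
Qed.

Local Close Scope ring_scope.

Theorem theorem2p9 (K : fieldType) (n : nat) (G : rel 'I_n)
  (G_sym : ssrbool.symmetric G) (G_irr : irreflexive G)
  (G_chordal : chordal G)
  (G_cliques : forall A B : {set 'I_n},
     A \in maximal_cliques G -> B \in maximal_cliques G -> A <> B ->
     #|A :&: B| <= 1) :
  reg_quotient_le (@binomial_edge_ideal K n G) #|maximal_cliques G|.
Proof.
have GE i j := maximal_cliques_cover i j G_sym G_irr.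
have JE f := binomial_edge_idealE (K := K) f G_sym GE.
apply: koszul_reg_quotient.
  have subI := edge_ideal_submod K (block_rel (enum (maximal_cliques G))) (vars set0).
  by split=> [|u v /JE Ju /JE Jv|a u /JE Ju]; apply/JE;
    [apply: (submod0 subI) | apply: (submodD subI) | apply: (submodZ subI)].
rewrite cardE; apply: (koszul_reg_eq JE); exact: reg_clique_cover.
Qed.
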